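(* Let $\alpha\colon P\to Q$ be a monotone map of finite posets and consider the pullback diagram $$\begin{array}{ccc} X&\xrightarrow{\ \beta\ }&h(Q)\\ {\scriptstyle f}\downarrow&&\downarrow{\scriptstyle r_Q}\\ P&\xrightarrow{\ \alpha\ }&Q. \end{array}$$ If $\alpha$ is a stratification map, then $f^*\colon X^*\to P^*$ is a fiberwise subdivision map with respect to $\alpha^*\colon P^*\to Q^*$ and the composition $X^*\xrightarrow{\beta^*}Q^\#\xrightarrow{\#}Q$.
   Context: All posets are finite; homeomorphisms of polyhedra are PL. $P^*$ is $P$ with the opposite order, $p^*$ is $p$ viewed in $P^*$, and $g^*\colon A^*\to B^*$ is a monotone map $g\colon A\to B$ viewed as a map of dual posets. For $p\in P$: $\lceil p\rceil=\{x\le p\}$, $\partial\lceil p\rceil=\{x<p\}$, $\lfloor p\rfloor=\{x\ge p\}$, $\mathrm{lk}(p,P)=\{x>p\}$. $|P|$ is the polyhedron given by the geometric realization of the simplicial complex of nonempty chains of $P$. $CX$ is a poset $X$ with a greatest element adjoined; for a polyhedron $Y$, $CY$ is the cone ($C\emptyset$ is a point), and $|CX|=C|X|$. The pullback of monotone maps $A\to D\leftarrow B$ is the subposet of $A\times B$ (product order) of pairs having the same image in $D$. $Q^\#$ is the poset of all intervals $[\sigma,\tau]=\{x:\sigma\le x\le\tau\}$ ($\sigma\le\tau$) of $Q$ ordered by inclusion; $h(Q)=(Q^\#)^*$; $r_Q\colon h(Q)\to Q$ is the monotone map $[\sigma,\tau]^*\mapsto\sigma$; $\#\colon Q^\#\to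 Q$ is the monotone map $[\sigma,\tau]\mapsto\tau$. A closed subposet $D$ of $A$ (i.e. $a\le d\in D$ implies $a\in D$) is collared in $A$ if for every $d\in D$, $|\mathrm{lk}(d,A)|$ is homeomorphic to the cone over $|\mathrm{lk}(d,D)|$ keeping $|\mathrm{lk}(d,D)|$ fixed. A monotone map $\alpha\colon P\to Q$ is a stratification map if $\alpha^{-1}(\partial\lceil q\rceil)$ is collared in $\alpha^{-1}(\lceil q\rceil)$ for each $q\in Q$. A subdivision map is a monotone map $g\colon A'\to A$ such that for each $a\in A$, $|g^{-1}(\lceil a\rceil)|$ is homeomorphic to $|Cg^{-1}(\partial\lceil a\rceil)|$ keeping $|g^{-1}(\partial\lceil a\rceil)|$ fixed. Fiberwise subdivision map (the version used here): a subdivision map $g\colon A'\to A$ is fiberwise with respect to monotone maps $\pi\colon A\to B$ and $\pi'\colon A'\to B^*$ if $g$ sends $(\pi')^{-1}(\lceil b^*\rceil)$ onto $\pi^{-1}(\lfloor b\rfloor)$ for each $b\in B$, and for each $a\in A$ there exists a homeomorphism $h_a\colon|g^{-1}(\lceil a\rceil)|\to C|g^{-1}(\partial\lceil a\rceil)|$ keeping $|g^{-1}(\partial\lceil a\rceil)|$ fixed and sending $|(\pi')^{-1}(\lceil b^*\rceil)\cap g^{-1}(\lceil a\rceil)|$ onto $C|(\pi')^{-1}(\lceil b^*\rceil)\cap g^{-1}(\partial\lceil a\rceil)|$ for every $b\in B$ (this last condition is void when $(\pi')^{-1}(\lceil b^*\rceil)\cap g^{-1}(\lceil a\rceil)$ is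 empty). In the claim, $g=f^*$, $A'=X^*$, $A=P^*$, $B=Q^*$ and $B^*=Q$. *)

(* Defs.v *)
From HB Require Import structures.
From mathcomp Require Import all_boot all_order all_algebra.
From mathcomp Require Import all_classical reals.

Set Implicit Arguments.
Unset Strict Implicit.
Unset Printing Implicit Defensive.

Import Order.TTheory GRing.Theory Num.Theory.

Local Open Scope ring_scope.

(* A finite poset is a [finPOrderType]; a subposet of [T] is a finite set
   [A : {set T}] with the order of [T]; [P^*] is [P^d]. *)

Section Subposets.
Context {d : Order.disp_t} {T : finPOrderType d}.
Implicit Types (p : T) (A D : {set T}).

Definition down_set p : {set T} := [set x | (x <= p)%O]%SET.
Definition bd_down_set p : {set T} := [set x | (x < p)%O]%SET.
Definition up_set p : {set T} := [set x | (p <= x)%O]%SET.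

(* lk(p, A), for a subposet A *)
Definition lk p A : {set T} := [set x in A | (p < x)%O]%SET.

Definition closed_sub D A : Prop :=
  D \subset A /\ forall a x, a \in A -> x \in D -> (a <= x)%O -> a \in D.

End Subposets.

Definition monotone_map {dA dB} {A : finPOrderType dA} {B : finPOrderType dB}
  (g : A -> B) : Prop := {homo g : x y / (x <= y)%O}.

Definition dual_map {dA dB} {A : finPOrderType dA} {B : finPOrderType dB}
  (g : A -> B) : A^d -> B^d := g.

(** ** [CT]: the poset [T] with a greatest element [None] adjoined *)

Definition cone_poset {d} (T : finPOrderType d) : Type := option T.

Section ConePoset.
Context {d : Order.disp_t} {T : finPOrderType d}.

HB.instance Definition _ := Finite.on (cone_poset T).

Definition cone_le (x y : cone_poset T) : bool :=
  match x, y with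
  | _, None => true
  | None, Some _ => false
  | Some a, Some b => (a <= b)%O
  end.

Fact cone_le_refl : reflexive cone_le.
Proof. by case=> [a|] //=. Qed.

Fact cone_le_anti : antisymmetric cone_le.
Proof. by case=> [a|] [b|] //= /le_anti ->. Qed.

Fact cone_le_trans : transitive cone_le.
Proof. by case=> [a|] [b|] [c|] //=; apply: le_trans. Qed.

HB.instance Definition _ := Order.Le_isPOrder.Build d (cone_poset T)
  cone_le_refl cone_le_anti cone_le_trans.

(* CA, as a subposet of CT *)
Definition cone_sub (A : {set T}) : {set cone_poset T} :=
  (None |: [set Some x | x in A])%SET.

End ConePoset.

(** ** The poset [Q^#] of intervals

    The interval [[s, t]] is encoded by the pair [(s, t)] with [s <= t], which
    it determines; the order is inclusion of the underlying sets. *)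

Definition sharp {d} (Q : finPOrderType d) : Type :=
  {st : Q * Q | (st.1 <= st.2)%O}.

Section Sharp.
Context {d : Order.disp_t} {Q : finPOrderType d}.

HB.instance Definition _ := Finite.on (sharp Q).

Definition itv_lo (I : sharp Q) : Q := (sval I).1.
Definition itv_hi (I : sharp Q) : Q := (sval I).2.

Definition itv_points (I : sharp Q) : {set Q} :=
  [set x | (itv_lo I <= x <= itv_hi I)%O]%SET.

Definition itv_le (I J : sharp Q) : bool := itv_points I \subset itv_points J.

Lemma itv_leE I J :
  itv_le I J = (itv_lo J <= itv_lo I)%O && (itv_hi I <= itv_hi J)%O.
Proof.
apply/fintype.subsetP/andP => [sIJ|[lo hi] x]; last first.
  by rewrite !inE => /andP[? ?]; rewrite (le_trans lo) ?(le_trans _ hi).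
have leI : (itv_lo I <= itv_hi I)%O by exact: (svalP I).
have := sIJ (itv_lo I); have := sIJ (itv_hi I).
by rewrite !inE !lexx leI => /(_ isT) /andP[_ ->] /(_ isT) /andP[-> _].
Qed.

Fact itv_le_refl : reflexive itv_le.
Proof. by move=> I; exact: subxx. Qed.

Fact itv_le_anti : antisymmetric itv_le.
Proof.
move=> I J; rewrite !itv_leE => /andP[/andP[a b] /andP[c e]].
apply/val_inj; rewrite /= [LHS]surjective_pairing [RHS]surjective_pairing.
by congr pair; apply: le_anti; rewrite -/(itv_lo _) -/(itv_hi _) ?a ?b ?c ?e.
Qed.

Fact itv_le_trans : transitive itv_le.
Proof. by move=> J I K; exact: fintype.subset_trans. Qed.

HB.instance Definition _ := Order.Le_isPOrder.Build d (sharp Q)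
  itv_le_refl itv_le_anti itv_le_trans.

(* the map # : Q^# -> Q *)
Definition sharp_map : sharp Q -> Q := itv_hi.

End Sharp.

Notation hposet Q := ((sharp Q)^d) (only parsing).

(* r_Q : h(Q) -> Q *)
Definition r_map {d} {Q : finPOrderType d} (I : hposet Q) : Q :=
  itv_lo (I : sharp Q).


Definition pullback {dA dB dD} {A : finPOrderType dA} {B : finPOrderType dB}
    {D : finPOrderType dD} (u : A -> D) (v : B -> D) : Type :=
  {x : A *p B | u x.1 == v x.2}.

Section Pullback.
Context {dA dB dD : Order.disp_t} {A : finPOrderType dA}
  {B : finPOrderType dB} {D : finPOrderType dD} (u : A -> D) (v : B -> D).

HB.instance Definition _ := SubType.on (pullback u v).
HB.instance Definition _ := Finite.on (pullback u v).
HB.instance Definition _ := 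
  [SubChoice_isSubPOrder of pullback u v by <: with Order.prod_display dA dB].

Definition pb_fst (x : pullback u v) : A := (sval x).1.
Definition pb_snd (x : pullback u v) : B := (sval x).2.

End Pullback.


Local Open Scope classical_set_scope.

Section PL.
Context {R : realType}.

Definition conv_hull {V : lmodType R} (s : seq V) : set V :=
  [set x | exists c : 'I_(size s) -> R,
     [/\ forall i, 0 <= c i, \sum_i c i = 1 & x = \sum_i c i *: s`_i]].

Definition affine_on {V W : lmodType R} (X : set V) (h : V -> W) : Prop :=
  forall x y t, X x -> X y -> 0 <= t <= 1 ->
    h ((1 - t) *: x + t *: y) = (1 - t) *: h x + t *: h y.

(* A map, of which only the values on X matter, is PL on X when X is a union of
   finitely many convex polytopes on each of which the map is affine.  Then X is
   a compact polyhedron, and continuity on X is automatic because the pieces are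
   closed and finite in number. *)
Definition pl_on {V W : lmodType R} (X : set V) (h : V -> W) : Prop :=
  exists K : seq (seq V),
    X = \bigcup_(s in [set` K]) conv_hull s /\
    forall s, s \in K -> affine_on (conv_hull s) h.

Definition pl_homeo {V W : lmodType R} (X : set V) (Y : set W) (h : V -> W) :
    Prop :=
  [/\ set_bij X Y h, pl_on X h &
      exists k : W -> V, {in X, cancel h k} /\ pl_on Y k].

End PL.

Section Realization.
Context (R : realType) {d : Order.disp_t} {T : finPOrderType d}.

(* |A| in R^T, in barycentric coordinates: the vertex x is the basis vector at
   x, and the support of a point is a chain of A.  Hence |D| is literally a
   subset of |A| when D is a subposet of A. *)
Definition realization (A : {set T}) : set {ffun T -> R^o} :=
  [set w | [/\ forall x, 0 <= w x,
               \sum_x w x = 1,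
               forall x, w x != 0 -> x \in A &
               forall x y, w x != 0 -> w y != 0 -> (x >=< y)%O]].

(* the point (1 - t) y + t * apex of the cone over a polyhedron in R^T; the
   cone lives in R^(CT), the apex being the basis vector at None *)
Definition cone_pt (t : R) (y : {ffun T -> R^o}) : {ffun cone_poset T -> R^o} :=
  [ffun x => if x is Some z then (1 - t) * y z else t].

Definition cone_apex : {ffun cone_poset T -> R^o} := cone_pt 1 0.

Definition cone_base (y : {ffun T -> R^o}) : {ffun cone_poset T -> R^o} :=
  cone_pt 0 y.

(* CY; the apex is added separately so that C(empty) is a point *)
Definition cone (Y : set {ffun T -> R^o}) : set {ffun cone_poset T -> R^o} :=
  [set z | z = cone_apex \/
     exists t y, [/\ 0 <= t <= 1, Y y & z = cone_pt t y]].

End Realization.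

Arguments realization R {d T} A.
Arguments cone_base {R d T} y.
Arguments cone {R d T} Y.

Lemma realization_cone (R : realType) d (T : finPOrderType d) (A : {set T}) :
  realization R (cone_sub A) = cone (realization R A).
Proof.
have sumE (z : {ffun cone_poset T -> R^o}) :
    \sum_x z x = z None + \sum_a z (Some a).
  rewrite (bigD1 None) //=; congr (_ + _).
  rewrite (reindex_omap Some id) /=; last by case.
  by apply: eq_bigl => a; rewrite eqxx.
have inS a : (Some a \in cone_sub A) = (a \in A).
  by rewrite /cone_sub in_setU1 /= mem_imset // => ? ? [].
apply/seteqP; split=> z /=.
- move=> [z0 z1 zA zC]; move: (z1); rewrite sumE => z1'.
  have [zN1|zN1] := eqVneq (z None) 1.
    left; apply/ffunP => -[a|]; rewrite !ffunE ?subrr ?mul0r //.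
    have s0 : \sum_a z (Some a) = 0.
      by move: z1'; rewrite zN1 -[RHS]addr0 => /addrI.
    by apply: (psumr_eq0P _ s0).
  have sE : \sum_a z (Some a) = 1 - z None by rewrite -z1' addrC addKr.
  have t1 : 1 - z None != 0 by rewrite subr_eq0 eq_sym.
  have t0 : 0 <= 1 - z None by rewrite -sE sumr_ge0.
  right; exists (z None), [ffun a => z (Some a) / (1 - z None)]; split.
  + by rewrite z0 -subr_ge0.
  + have nz a : [ffun a => z (Some a) / (1 - z None)] a != 0 -> z (Some a) != 0.
      by rewrite ffunE mulf_eq0 negb_or => /andP[].
    split.
    * by move=> a; rewrite ffunE divr_ge0.
    * under eq_bigr do rewrite ffunE.
      by rewrite -mulr_suml sE divff.
    * by move=> a /nz /zA; rewrite inS.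
    * by move=> a b /nz za /nz zb; have := zC _ _ za zb.
  + by apply/ffunP => -[a|]; rewrite !ffunE // mulrC divfK.
- case=> [->|[t [y [/andP[t0 t1] [y0 y1 yA yC] ->]]]].
    split.
    * by case=> [a|]; rewrite !ffunE ?subrr ?mul0r ?ler01.
    * rewrite sumE big1 ?ffunE ?addr0 // => a _.
      by rewrite !ffunE subrr mul0r.
    * by case=> [a|]; [rewrite !ffunE subrr mul0r eqxx | rewrite setU11].
    * by case=> [a|] [b|]; rewrite !ffunE ?subrr ?mul0r ?eqxx.
have nz a : cone_pt t y (Some a) != 0 -> y a != 0.
  by rewrite ffunE mulf_eq0 negb_or => /andP[].
split.
* by case=> [a|]; rewrite ffunE // mulr_ge0 // subr_ge0.
* rewrite sumE ffunE; under eq_bigr do rewrite ffunE.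
  by rewrite -mulr_sumr y1 mulr1 addrC subrK.
* by case=> [a /nz /yA|]; rewrite ?inS // setU11.
* case=> [a|] [b|] //; first by move=> /nz ya /nz yb; exact: yC.
Qed.


Section Maps.
Context (R : realType).

Definition collared {d} {T : finPOrderType d} (D A : {set T}) : Prop :=
  closed_sub D A /\
  forall x, x \in D -> exists h : {ffun T -> R^o} -> {ffun cone_poset T -> R^o},
    pl_homeo (realization R (lk x A)) (cone (realization R (lk x D))) h /\
    {in realization R (lk x D), h =1 cone_base}.

Definition stratification_map {dP dQ} {P : finPOrderType dP}
    {Q : finPOrderType dQ} (alpha : P -> Q) : Prop :=
  monotone_map alpha /\
  forall q : Q,
    collared (alpha @^-1: bd_down_set q)%SET (alpha @^-1: down_set q)%SET.

Definition subdivision_map {dA' dA} {A' : finPOrderType dA'}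
    {A : finPOrderType dA} (g : A' -> A) : Prop :=
  monotone_map g /\
  forall a : A, exists h : {ffun A' -> R^o} -> {ffun cone_poset A' -> R^o},
    pl_homeo (realization R (g @^-1: down_set a)%SET)
             (realization R (cone_sub (g @^-1: bd_down_set a)%SET)) h /\
    {in realization R (g @^-1: bd_down_set a)%SET, h =1 cone_base}.

Definition fiberwise_subdivision_map {dA' dA dB} {A' : finPOrderType dA'}
    {A : finPOrderType dA} {B : finPOrderType dB}
    (g : A' -> A) (pi : A -> B) (pi' : A' -> B^d) : Prop :=
  [/\ subdivision_map g,
      monotone_map pi /\ monotone_map pi',
      forall b : B,
        (g @: (pi' @^-1: down_set (b : B^d)) = pi @^-1: up_set b)%SET &
      forall a : A, exists h : {ffun A' -> R^o} -> {ffun cone_poset A' -> R^o},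
      [/\ pl_homeo (realization R (g @^-1: down_set a)%SET)
                   (cone (realization R (g @^-1: bd_down_set a)%SET)) h,
          {in realization R (g @^-1: bd_down_set a)%SET, h =1 cone_base} &
          forall b : B,
          let F : {set A'} := (pi' @^-1: down_set (b : B^d))%SET in
          (F :&: g @^-1: down_set a != finset.set0)%SET ->
          h @` realization R (F :&: g @^-1: down_set a)%SET
          = cone (realization R (F :&: g @^-1: bd_down_set a)%SET)]].

End Maps.

(* Main.v *)
From HB Require Import structures.
Require Import Defs.
From mathcomp Require Import all_boot all_order all_algebra.
From mathcomp Require Import all_classical reals.
From mathcomp Require Import ring lra.

(** Write the dual of the pullback as the set of pairs (p, t) with
    alpha p <= t, ordered so that it reverses the order of P and keeps that of
    Q.
    For a in P and a lower set B of Q containing alpha a, let Z_B and Y_B be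
    the sets of pairs with t in B and with p >= a, resp. p > a.  The theorem
    says that |Z_B| is the cone over |Y_B|, rel |Y_B| and compatibly with all
    smaller lower sets, for B = Q; [coning_lower] proves it for every B.

    The proof is an induction on a, from the top of P downwards, and for
    fixed a on B.  When B has no element greater than alpha a, the
    poset Z_B is Y_B with the greatest element (a, alpha a) added, so |Z_B| is
    literally a cone ([coning_min]).  Now let a maximal element q > alpha a be
    added to B.  The new part is |Z| over {t <= q}, a cone with vertex (a, q)
    over the union of |Y| over {t <= q} and |Z| over {t < q}.  Put
    W = |Y| over {t < q}.

    - By the induction on B, |Z| over {t < q} is a cone over W, rel W.
    - By the induction on a, the pair (|Y| over {t <= q}, W) is PL homeomorphic
      to the pair (|E|, |E'|) of links of a in the preimages of {<= q} and
      {< q} under alpha: over each vertex m of E, the cone from m over its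
      link is matched with the cone that the induction provides
      ([flattening_step], [flatten]).  Since alpha is a stratification map,
      |E| is a cone over |E'|; so |Y| over {t <= q} is a cone over W as well.

    So the base of the new part is a suspension of W.  The cone over a
    suspension, with vertex in the middle of the segment joining the two
    suspension points, is the join of W with that segment, that is, the cone
    over one of the two cones ([double_cone]).  This turns the new part
    into the cone over |Y| over {t <= q} ([extend_coning]), by a homeomorphism
    that agrees with the old one where they meet ([coning_add]).

    PL homeomorphisms are handled through their graphs: a map is PL exactly
    when its graph is a finite union of polytopes ([iso_of_homeo],
    [pl_on_of_graph]).  Inverses and unions are then immediate, the cone
    extension of a homeomorphism is the cone over its graph ([iso_gcone]), and
    composition and restriction reduce to the fact that a fibre product of
    polytopes is a polytope ([polyhedron_fibre_prod]), which follows from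
    cutting a convex hull by hyperplanes ([conv_hull_cut]). *)

Set Implicit Arguments.
Unset Strict Implicit.
Unset Printing Implicit Defensive.

Import Order.TTheory GRing.Theory Num.Theory.

Local Open Scope ring_scope.
Local Open Scope classical_set_scope.

(** * Polytopes as convex hulls, and polyhedra *)

Section Convex.
Context {R : realType}.
Implicit Types V W : lmodType R.

Definition polyhedron V (X : set V) : Prop :=
  exists K : seq (seq V), X = \bigcup_(s in [set` K]) conv_hull s.

Lemma conv_hull_comb V (s : seq V) (I : finType) (c : I -> R) (x : I -> V) :
  (forall i, 0 <= c i) -> \sum_i c i = 1 ->
  (forall i, c i != 0 -> conv_hull s (x i)) ->
  conv_hull s (\sum_i c i *: x i).
Proof.
move=> c0 c1 xs.
have ex i : exists e : 'I_(size s) -> R, c i != 0 ->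
    [/\ forall j, 0 <= e j, \sum_j e j = 1 & x i = \sum_j e j *: s`_j].
  have [ci|ci] := eqVneq (c i) 0; first by exists (fun=> 0).
  by have [e he] := xs i ci; exists e.
have [e he] := choice ex.
exists (fun j => \sum_i c i * e i j); split.
- move=> j; apply: sumr_ge0 => i _; have [->|ci] := eqVneq (c i) 0.
    by rewrite mul0r.
  by have [e0 _ _] := he i ci; rewrite mulr_ge0.
- rewrite exchange_big /= -c1; apply: eq_bigr => i _; rewrite -mulr_sumr.
  have [->|ci] := eqVneq (c i) 0; first by rewrite mul0r.
  by have [_ -> _] := he i ci; rewrite mulr1.
- under [RHS]eq_bigr do rewrite scaler_suml.
  rewrite exchange_big /=; apply: eq_bigr => i _.
  have [->|ci] := eqVneq (c i) 0.
    by rewrite scale0r big1 // => j _; rewrite mul0r scale0r.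
  have [_ _ ->] := he i ci; rewrite scaler_sumr.
  by apply: eq_bigr => j _; rewrite scalerA.
Qed.

Lemma conv_hull_mem V (s : seq V) v : v \in s -> conv_hull s v.
Proof.
move=> vs; have ks : (index v s < size s)%N by rewrite index_mem.
exists (fun j => (j == Ordinal ks)%:R); split.
- by move=> j; rewrite ler0n.
- by rewrite (bigD1 (Ordinal ks)) //= eqxx big1 ?addr0 // => i /negbTE ->.
- rewrite (bigD1 (Ordinal ks)) //= eqxx big1 ?addr0 ?scale1r ?nth_index //.
  by move=> i /negbTE ->; rewrite scale0r.
Qed.

Lemma conv_hull_sub V (r s : seq V) :
  (forall v, v \in r -> conv_hull s v) -> conv_hull r `<=` conv_hull s.
Proof.
move=> rs x [c [c0 c1 ->]]; apply: conv_hull_comb => // i _.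
by apply: rs; rewrite mem_nth.
Qed.

Lemma conv_hull_convex V (s : seq V) x y t :
  conv_hull s x -> conv_hull s y -> 0 <= t <= 1 ->
  conv_hull s ((1 - t) *: x + t *: y).
Proof.
move=> sx sy /andP[t0 t1].
have -> : (1 - t) *: x + t *: y =
    \sum_(b : bool) (if b then 1 - t else t) *: (if b then x else y).
  by rewrite big_bool.
apply: conv_hull_comb; last by case.
- by case=> //; rewrite subr_ge0.
- by rewrite big_bool /= subrK.
Qed.

Lemma affine_comb V W (s : seq V) (f : V -> W) n (e : 'I_n -> R)
    (x : nat -> V) : affine_on (conv_hull s) f ->
  (forall i : 'I_n, conv_hull s (x i)) -> (forall i, 0 <= e i) ->
  \sum_i e i = 1 -> f (\sum_i e i *: x i) = \sum_i e i *: f (x i).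
Proof.
move=> fs; elim: n e x => [|n IH] e x xs e0.
  by rewrite big_ord0 => /eqP; rewrite eq_sym oner_eq0.
rewrite !big_ord_recl /= => e1.
have S0 : 0 <= \sum_(i < n) e (lift ord0 i) by apply: sumr_ge0.
set S := \sum_(i < n) e (lift ord0 i) in e1 S0.
have SE : S = 1 - e ord0 by rewrite -e1 addrC addKr.
have [SZ|SN] := eqVneq S 0.
  have z i : e (lift ord0 i) = 0.
    by move: SZ => /psumr_eq0P => /(_ (fun i _ => e0 _)) ->.
  have -> : e ord0 = 1 by rewrite -e1 SZ addr0.
  by rewrite !big1 ?addr0 ?scale1r // => i _; rewrite z scale0r.
have eE (U : lmodType R) (F : 'I_n -> U) : \sum_i e (lift ord0 i) *: F i =
    (1 - e ord0) *: \sum_i (e (lift ord0 i) / S) *: F i.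
  rewrite -SE scaler_sumr; apply: eq_bigr => i _.
  by rewrite scalerA mulrC divfK.
have f1 : \sum_i e (lift ord0 i) / S = 1 by rewrite -mulr_suml divff.
have f0 i : 0 <= e (lift ord0 i) / S by rewrite divr_ge0.
rewrite addrC eE fs; first last.
- by rewrite e0 -e1 lerDl.
- exact: (xs ord0).
- by apply: conv_hull_comb => // i _; exact: (xs (lift ord0 i)).
rewrite [RHS]addrC [in RHS]eE; congr (_ *: _ + _).
by apply: (IH _ (fun i => x i.+1)) => // i; exact: (xs (lift ord0 i)).
Qed.

Lemma conv_hull_affine V W (f : V -> W) (s : seq V) :
  affine_on (conv_hull s) f -> f @` conv_hull s = conv_hull (map f s).
Proof.
move=> fs; apply/seteqP; split=> [_ [x [c [c0 c1 ->]] <-]|y [c [c0 c1 ->]]].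
  rewrite (affine_comb (x := nth 0 s) fs) // => [|i].
    apply: conv_hull_comb => // i _; apply: conv_hull_mem.
    by apply: map_f; rewrite mem_nth.
  by apply: conv_hull_mem; rewrite mem_nth.
have sz (i : 'I_(size (map f s))) : (i < size s)%N.
  by rewrite -(size_map f) ltn_ord.
have si (i : 'I_(size (map f s))) : conv_hull s s`_i.
  by apply: conv_hull_mem; rewrite mem_nth ?sz.
exists (\sum_i c i *: s`_i).
  exact: (@conv_hull_comb V s _ c (fun i => s`_i)).
rewrite (affine_comb (x := nth 0 s) fs) //; apply: eq_bigr => i _.
by rewrite (nth_map 0) ?sz.
Qed.

Lemma conv_hull_image V W (f : {linear V -> W}) (s : seq V) :
  f @` conv_hull s = conv_hull (map f s).
Proof.
by apply: conv_hull_affine => x y t _ _ _; rewrite linearD !linearZ.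
Qed.

Lemma conv_hull_prod V W (s : seq V) (t : seq W) :
  conv_hull s `*` conv_hull t = conv_hull [seq (v, w) | v <- s, w <- t].
Proof.
set r := [seq _ | _ <- _, _ <- _].
apply/seteqP; split=> [[_ _] /= [[c [c0 c1 ->]] [e [e0 e1 ->]]]|[x y] rxy].
  have -> : (\sum_i c i *: s`_i, \sum_j e j *: t`_j) =
      \sum_(k : 'I_(size s) * 'I_(size t))
        (c k.1 * e k.2) *: ((s`_k.1, t`_k.2) : V * W).
    rewrite -(pair_bigA _ (fun i j => (c i * e j) *: (s`_i, t`_j))) /=.
    have pE (I : finType) (F : I -> V * W) :
        \sum_i F i = (\sum_i (F i).1, \sum_i (F i).2).
      by rewrite [LHS]surjective_pairing (raddf_sum fst) (raddf_sum snd).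
    rewrite pE; congr pair.
      apply: eq_bigr => i _; rewrite pE /=.
      by under eq_bigr do rewrite mulrC -scalerA; rewrite -scaler_suml e1 scale1r.
    under [RHS]eq_bigr do rewrite pE /=.
    rewrite exchange_big /=; apply: eq_bigr => j _.
    by under eq_bigr do rewrite -scalerA; rewrite -scaler_suml c1 scale1r.
  apply: conv_hull_comb => [k||k _]; first exact: mulr_ge0.
    rewrite -(pair_bigA _ (fun i j => c i * e j)) /= -c1.
    by apply: eq_bigr => i _; rewrite -mulr_sumr e1 mulr1.
  by apply: conv_hull_mem; apply: allpairs_f; rewrite mem_nth.
split=> /=.
  have : (fst @` conv_hull r) x by exists (x, y).
  rewrite (conv_hull_image fst); apply: conv_hull_sub => v /mapP[z zr ->].
  by case/allpairsP: zr => -[a b] /= [? ? ->]; exact: conv_hull_mem.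
have : (snd @` conv_hull r) y by exists (x, y).
rewrite (conv_hull_image snd); apply: conv_hull_sub => v /mapP[z zr ->].
by case/allpairsP: zr => -[a b] /= [? ? ->]; exact: conv_hull_mem.
Qed.

(** A polytope is cut by the hyperplane l = 0 in the hull of its vertices on
    the hyperplane and of the points [mid v w] where an edge from a vertex [v]
    with l > 0 to a vertex [w] with l < 0 crosses it.  In a convex combination
    with l = 0, the total positive weight of l equals the total negative one
    ([M = N]); distributing every positive vertex over the negative ones in
    proportion to c_j * - l s_j, and conversely, rewrites the combination in
    terms of the crossing points. *)
Lemma conv_hull_cut V (l : {linear V -> R^o}) (s : seq V) :
  exists s', conv_hull s `&` [set x | l x = 0] = conv_hull s'.
Proof.
pose mid (v w : V) := (l v - l w)^-1 *: (- l w *: v + l v *: w).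
pose s0 := [seq v <- s | l v == 0].
pose sp := [seq v <- s | 0 < l v].
pose sn := [seq v <- s | l v < 0].
exists (s0 ++ [seq mid v w | v <- sp, w <- sn]).
have lmid v w : 0 < l v -> l w < 0 -> l v - l w != 0 by move=> ? ?; lra.
apply/seteqP; split=> [x [[c [c0 c1 ->]]] /= lx|x /= hx].
  set t := _ ++ _.
  have lx' : \sum_i c i * l s`_i = 0.
    move: lx; rewrite linear_sum => lx; apply: etrans lx.
    by apply: (@eq_bigr R^o) => i _; rewrite linearZ.
  pose n := size s; pose N := \sum_(j < n | l s`_j < 0) c j * - l s`_j.
  pose M := \sum_(i < n | 0 < l s`_i) c i * l s`_i.
  have MN : M = N.
    apply/eqP; rewrite -subr_eq0 -lx' (bigID (fun i : 'I_n => 0 < l s`_i)) /=.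
    rewrite -/M; apply/eqP; congr (_ + _); rewrite /N -sumrN.
    under [LHS]eq_bigr do rewrite mulrN opprK.
    rewrite big_mkcond [RHS]big_mkcond /=; apply: eq_bigr => i _.
    rewrite -leNgt le_eqVlt; by case: ltgtP => //= ->; rewrite mulr0.
  have M0 : 0 <= M by apply: sumr_ge0 => i /ltW ?; rewrite mulr_ge0.
  have t0 (i : 'I_n) : l s`_i = 0 -> conv_hull t s`_i.
    move=> li; apply: conv_hull_mem; rewrite mem_cat mem_filter li eqxx.
    by rewrite mem_nth.
  have [ME|M1] := eqVneq M 0.
    apply: conv_hull_comb => // i ci; apply: t0.
    have := ME => /psumr_eq0P => /(_ (fun i p => mulr_ge0 (c0 i) (ltW p))) hM.
    move: (MN); rewrite ME => /esym /psumr_eq0P.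
    have nn (j : 'I_n) : l s`_j < 0 -> 0 <= c j * - l s`_j.
      by move=> lj; rewrite mulr_ge0 // oppr_ge0 ltW.
    move=> /(_ nn) hN; case: (ltgtP (l s`_i) 0) => // li.
      have /eqP := hN i li; rewrite mulf_eq0 oppr_eq0 (negbTE ci) /= => /eqP.
      by move=> l0; move: li; rewrite l0 ltxx.
    have /eqP := hM i li; rewrite mulf_eq0 (negbTE ci) /= => /eqP.
    by move=> l0; move: li; rewrite l0 ltxx.
  have Mp : 0 < M by rewrite lt_def M1.
  pose e (k : 'I_n + 'I_n * 'I_n) : R := match k with
    | inl i => if l s`_i == 0 then c i else 0
    | inr (i, j) => if (0 < l s`_i) && (l s`_j < 0)
        then c i * c j * (l s`_i - l s`_j) / M else 0 end.
  pose y (k : 'I_n + 'I_n * 'I_n) : V := match k with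
    | inl i => s`_i | inr (i, j) => mid s`_i s`_j end.
  have sumE (U : nmodType) (F : 'I_n + 'I_n * 'I_n -> U) :
      \sum_k F k = \sum_i F (inl i) + \sum_i \sum_j F (inr (i, j)).
    by rewrite big_sumType /= (pair_bigA _ (fun i j => F (inr (i, j)))) /=;
       congr (_ + _); apply: eq_bigr => -[].
  (* Used with g the vertices themselves, and with g = 1 for the total weight. *)
  have key (U : lmodType R) (g : 'I_n -> U) :
      \sum_(i < n) (if l s`_i == 0 then c i else 0) *: g i +
      \sum_(i < n) \sum_(j < n) (if (0 < l s`_i) && (l s`_j < 0)
         then c i * c j / M else 0) *: (- l s`_j *: g i + l s`_i *: g j) = \sum_i c i *: g i.
    pose A := \sum_(i < n | 0 < l s`_i) c i *: g i.
    pose B := \sum_(i < n | l s`_i < 0) c i *: g i.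
    have -> : \sum_(i < n) \sum_(j < n) (if (0 < l s`_i) && (l s`_j < 0)
        then c i * c j / M else 0) *: (- l s`_j *: g i + l s`_i *: g j) = A + B.
      transitivity (\sum_(i < n | 0 < l s`_i) \sum_(j < n | l s`_j < 0)
        ((c j * - l s`_j / M) *: (c i *: g i) +
         (c i * l s`_i / M) *: (c j *: g j))).
        rewrite [RHS]big_mkcond; apply: eq_bigr => i _.
        case: ltP => li /=; last by rewrite big1 // => j _; rewrite scale0r.
        rewrite [RHS]big_mkcond; apply: eq_bigr => j _.
        case: ltP => lj /=; last by rewrite scale0r.
        by rewrite scalerDr !scalerA; congr (_ *: _ + _ *: _); ring.
      under eq_bigr do rewrite big_split /=.
      rewrite big_split /=; congr (_ + _).
        apply: eq_bigr => i _; rewrite -scaler_suml -mulr_suml.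
        by rewrite -/N -MN divff // scale1r.
      rewrite exchange_big /=; apply: eq_bigr => i _.
      by rewrite -scaler_suml -mulr_suml -/M divff // scale1r.
    rewrite /A /B [X in _ + (X + _)]big_mkcond [X in _ + (_ + X)]big_mkcond /=.
    rewrite -!big_split /=; apply: eq_bigr => i _.
    by case: ltgtP => li; rewrite ?scale0r ?add0r ?addr0.
  have -> : \sum_i c i *: s`_i = \sum_k e k *: y k.
    rewrite sumE -key; congr (_ + _).
    apply: eq_bigr => i _; apply: eq_bigr => j _ /=.
    case: ifP => [/andP[li lj]|]; last by rewrite !scale0r.
    rewrite /mid scalerA; congr (_ *: _).
    by rewrite [RHS]mulrAC mulfK // lmid.
  apply: conv_hull_comb.
  - case=> [i|[i j]] /=; first by case: ifP.
    case: ifP => // /andP[li lj].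
    rewrite mulr_ge0 ?invr_ge0 // mulr_ge0 ?mulr_ge0 // subr_ge0 ltW //.
    exact: lt_trans lj li.
  - rewrite sumE -c1; have := key R^o (fun=> 1).
    under [RHS]eq_bigr do rewrite /GRing.scale /= mulr1.
    move=> <-; congr (_ + _).
      by apply: eq_bigr => i _ /=; rewrite /GRing.scale /= mulr1.
    apply: eq_bigr => i _; apply: eq_bigr => j _ /=; rewrite /GRing.scale /=.
    case: ifP => _; last by rewrite mul0r.
    by rewrite !mulr1 mulrAC [- _ + _]addrC.
  - case=> [i|[i j]] /=; first by case: (l s`_i =P 0) => [/t0|_]; rewrite ?eqxx.
    case: ifP => [/andP[li lj]|]; last by rewrite eqxx.
    move=> _; apply: conv_hull_mem; rewrite mem_cat; apply/orP; right.
    by apply: allpairs_f; rewrite mem_filter ?li ?lj mem_nth.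
have mem v : v \in s0 ++ [seq mid v w | v <- sp, w <- sn] ->
    conv_hull s v /\ l v = 0.
  rewrite mem_cat => /orP[|/allpairsP[[v1 w] /= []]].
    rewrite mem_filter => /andP[/eqP ? ?]; split=> //; exact: conv_hull_mem.
  rewrite !mem_filter => /andP[lv vs] /andP[lw ws] ->; split; last first.
    by rewrite /mid linearZ linearD !linearZ /= /GRing.scale /=; ring.
  have d0 : 0 < l v1 - l w by lra.
  rewrite (_ : mid v1 w = (1 - l v1 / (l v1 - l w)) *: v1 +
                          (l v1 / (l v1 - l w)) *: w).
    apply: conv_hull_convex; try exact: conv_hull_mem.
    apply/andP; split; first by rewrite divr_ge0 // ltW.
    by rewrite ler_pdivrMr // mul1r; lra.
  rewrite /mid scalerDr !scalerA; congr (_ *: _ + _ *: _); field;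
    exact: lt0r_neq0.
split.
  by apply: conv_hull_sub hx => v /mem[].
move: hx => [c [c0 c1 ->]] /=; rewrite linear_sum big1 // => i _.
by rewrite linearZ /= (mem _ (mem_nth _ (ltn_ord i))).2 scaler0.
Qed.

Lemma conv_hull_cuts V (I : finType) (l : I -> {linear V -> R^o}) (s : seq V) :
  exists s', conv_hull s `&` [set x | forall i, l i x = 0] = conv_hull s'.
Proof.
have [s' es'] : exists s', conv_hull s `&`
    [set x | forall i, i \in enum I -> l i x = 0] = conv_hull s'.
  elim: (enum I) => [|i e [s' IH]].
    by exists s; apply/seteqP; split=> x //= [].
  have [s'' IH'] := conv_hull_cut (l i) s'; exists s''.
  rewrite -IH' -IH; apply/seteqP; split=> x /=.
    case=> sx lx; split; last by apply: lx; rewrite mem_head.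
    by split=> // j je; apply: lx; rewrite inE je orbT.
  by case=> -[sx lx] li; split=> // j; rewrite inE => /predU1P[->|/lx].
exists s'; rewrite -es'; apply/seteqP; split=> x /= [sx lx]; split=> // i.
by apply: lx; rewrite mem_enum.
Qed.

Lemma polyhedron_image V W (f : {linear V -> W}) (X : set V) :
  polyhedron X -> polyhedron (f @` X).
Proof.
move=> [K ->]; exists (map (map f) K); rewrite image_bigcup.
apply/seteqP; split=> y [s].
  by move=> /= sK hy; exists (map f s); [exact: map_f|rewrite -conv_hull_image].
by move=> /= /mapP[s' sK ->]; rewrite -conv_hull_image => ?; exists s'.
Qed.

Lemma polyhedronU V (X Y : set V) :
  polyhedron X -> polyhedron Y -> polyhedron (X `|` Y).
Proof.
move=> [K ->] [L ->]; exists (K ++ L); rewrite -bigcup_setU.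
by apply: eq_bigcupl; split=> s /=; rewrite mem_cat => /orP.
Qed.

Lemma fibre_prod_linear V W (I : finType) (u : {linear V -> {ffun I -> R^o}})
  (v : {linear W -> {ffun I -> R^o}}) i :
  linear (fun z : V * W => u z.1 i - v z.2 i : R^o).
Proof.
move=> a x y /=; rewrite !linearP !ffunE /= scalerBr opprD.
by rewrite addrACA.
Qed.

(** The product of two hulls is the hull of the pairs of vertices, and
    u x = v y is a finite system of linear equations, one per coordinate; this
    is why the common target is a coordinate space. *)
Lemma polyhedron_fibre_prod V W (I : finType)
    (u : {linear V -> {ffun I -> R^o}}) (v : {linear W -> {ffun I -> R^o}})
    (X : set V) (Y : set W) :
  polyhedron X -> polyhedron Y ->
  polyhedron [set z : V * W | [/\ X z.1, Y z.2 & u z.1 = v z.2]].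
Proof.
move=> [K ->] [L ->].
pose l i : {linear (V * W)%type -> R^o} :=
  HB.pack (fun z : V * W => u z.1 i - v z.2 i : R^o)
    (GRing.isLinear.Build _ _ _ _ _ (fibre_prod_linear u v i)).
have ex (st : seq V * seq W) : exists r,
    conv_hull [seq (a, b) | a <- st.1, b <- st.2] `&`
    [set z | forall i, l i z = 0] = conv_hull r by exact: conv_hull_cuts.
have [r rE] := choice ex.
have lE z : (forall i, l i z = 0) <-> u z.1 = v z.2.
  split=> [h|h i]; last by rewrite /= h subrr.
  by apply/ffunP => i; apply/eqP; rewrite -subr_eq0; apply/eqP/h.
exists [seq r (s, t) | s <- K, t <- L]; apply/seteqP; split=> z.
  move=> /= [[s sK sz] [t tL tz] uv]; exists (r (s, t)).
    exact: allpairs_f.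
  by rewrite -rE -conv_hull_prod; split=> //; apply/lE.
move=> /= [_ /allpairsP[[s t] /= [sK tL ->]]].
rewrite -rE -conv_hull_prod => -[[hs ht] /lE uv].
by split=> //; [exists s|exists t].
Qed.

End Convex.

(** * Piecewise linear homeomorphisms as polyhedral relations *)

Section Relations.
Context {R : realType}.
Implicit Types U V W : lmodType R.

(** The graph of a PL homeomorphism from X to Y.  Keeping the relation rather
    than a function makes the notion symmetric and lets homeomorphisms be glued
    by taking unions. *)
Record pl_iso V W (X : set V) (Y : set W) (G : set (V * W)) : Prop := PlIso {
  iso_poly : polyhedron G;
  iso_sub : forall x y, G (x, y) -> X x /\ Y y;
  iso_dom : forall x, X x -> exists y, G (x, y);
  iso_cod : forall y, Y y -> exists x, G (x, y);
  iso_fun : forall x y y', G (x, y) -> G (x, y') -> y = y';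
  iso_inj : forall x x' y, G (x, y) -> G (x', y) -> x = x' }.

(** For A in X and B in Y this says that the homeomorphism with graph G maps
    A onto B. *)
Definition respects V W (G : set (V * W)) (A : set V) (B : set W) : Prop :=
  forall x y, G (x, y) -> (A x <-> B y).

Definition converse V W (G : set (V * W)) : set (W * V) :=
  [set z | G (z.2, z.1)].

Definition rcomp U V W (G : set (U * V)) (H : set (V * W)) : set (U * W) :=
  [set z | exists2 y, G (z.1, y) & H (y, z.2)].

Definition restr V W (G : set (V * W)) (A : set V) : set (V * W) :=
  [set z | G z /\ A z.1].

Lemma respects_comp U V W (G : set (U * V)) (H : set (V * W)) A B C :
  respects G A B -> respects H B C -> respects (rcomp G H) A C.
Proof. by move=> GAB HBC x z [y /GAB -> /HBC ->]. Qed.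

Lemma swap_linear V W : linear (fun z : V * W => (z.2, z.1)).
Proof. by []. Qed.

Lemma iso_converse V W X Y (G : set (V * W)) :
  pl_iso X Y G -> pl_iso Y X (converse G).
Proof.
case=> Gp Gs Gd Gc Gf Gi; split.
- pose f : {linear (V * W)%type -> (W * V)%type} := HB.pack (fun z : V * W => (z.2, z.1))
    (GRing.isLinear.Build _ _ _ _ _ (@swap_linear V W)).
  rewrite (_ : converse G = f @` G); first exact: polyhedron_image.
  apply/seteqP; split=> -[y x]; first by exists (x, y).
  by case=> -[x' y'] ? [<- <-].
- by move=> y x /Gs[].
- by move=> y /Gc.
- by move=> x /Gd.
- by move=> y x x'; exact: Gi.
- by move=> y y' x; exact: Gf.
Qed.

Lemma proj14_linear U V W :
  linear (fun z : (U * V) * (V * W) => (z.1.1, z.2.2)).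
Proof. by []. Qed.

Lemma iso_comp U (I : finType) W X Y Z
    (G : set (U * {ffun I -> R^o})) (H : set ({ffun I -> R^o} * W)) :
  pl_iso X Y G -> pl_iso Y Z H -> pl_iso X Z (rcomp G H).
Proof.
case=> Gp Gs Gd Gc Gf Gi [Hp Hs Hd Hc Hf Hi]; split.
- pose f : {linear ((U * {ffun I -> R^o}) * ({ffun I -> R^o} * W))%type ->
      (U * W)%type} :=
    HB.pack (fun z : (U * {ffun I -> R^o}) * ({ffun I -> R^o} * W) =>
             (z.1.1, z.2.2))
    (GRing.isLinear.Build _ _ _ _ _ (@proj14_linear U {ffun I -> R^o} W)).
  have := polyhedron_image f (polyhedron_fibre_prod snd fst Gp Hp).
  congr polyhedron; apply/seteqP; split=> [xz [[[x y] [y' z]] [/=]]|[x z]].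
    by move=> Gxy Hyz yy' <-; exists y => //; rewrite yy'.
  by case=> y Gxy Hyz; exists ((x, y), (y, z)).
- by move=> x z [y /Gs[? _] /Hs[_ ?]].
- move=> x /Gd[y Gxy]; have [_ /Hd[z Hyz]] := Gs _ _ Gxy.
  by exists z, y.
- move=> z /Hc[y Hyz]; have [/Gc[x Gxy] _] := Hs _ _ Hyz.
  by exists x, y.
- by move=> x z z' [y Gxy Hyz] [y' /(Gf _ _ _ Gxy) <- /(Hf _ _ _ Hyz)].
- by move=> x x' z [y Gxy Hyz] [y' G' /(Hi _ _ _ Hyz) E]; apply: Gi Gxy _;
    rewrite E.
Qed.

Lemma iso_restr (I : finType) W X Y (G : set ({ffun I -> R^o} * W)) A B :
  pl_iso X Y G -> respects G A B -> polyhedron A -> A `<=` X -> B `<=` Y ->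
  pl_iso A B (restr G A).
Proof.
case=> Gp Gs Gd Gc Gf Gi GAB Ap AX BY; split.
- have := polyhedron_image fst (polyhedron_fibre_prod fst idfun Gp Ap).
  congr polyhedron; apply/seteqP; split=> [xz [[[x y] a] [/=]]|[x y] /= [Gxy Ax]].
    by move=> Gxy Aa xa <-; split; rewrite //= xa.
  by exists ((x, y), x).
- by move=> x y [Gxy Ax]; split=> //; apply/(GAB _ _ Gxy).
- by move=> x Ax; have [y Gxy] := Gd _ (AX _ Ax); exists y.
- move=> y By; have [x Gxy] := Gc _ (BY _ By); exists x; split=> //.
  exact/(GAB _ _ Gxy).
- by move=> x y y' [Gxy _] [Gxy' _]; exact: Gf Gxy Gxy'.
- by move=> x x' y [Gxy _] [Gxy' _]; exact: Gi Gxy Gxy'.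
Qed.

(** Two homeomorphisms glue as soon as the second is contained in the first
    over the overlap of the sources and over the overlap of the targets: the
    former makes the union single-valued, the latter makes it injective. *)
Lemma iso_glue V W X Y X' Y' (G H : set (V * W)) :
  pl_iso X Y G -> pl_iso X' Y' H ->
  (forall x y, H (x, y) -> X x -> G (x, y)) ->
  (forall x y, H (x, y) -> Y y -> G (x, y)) ->
  pl_iso (X `|` X') (Y `|` Y') (G `|` H).
Proof.
case=> Gp Gs Gd Gc Gf Gi [Hp Hs Hd Hc Hf Hi] HX HY; split.
- exact: polyhedronU.
- by move=> x y [/Gs[]|/Hs[]]; split; by [left|right].
- by move=> x [/Gd|/Hd] [y]; exists y; [left|right].
- by move=> y [/Gc|/Hc] [x]; exists x; [left|right].
- move=> x y y' [Gxy|Hxy] [Gxy'|Hxy'].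
  + exact: Gf Gxy Gxy'.
  + by apply: Gf (Gxy) _; apply: HX => //; case: (Gs _ _ Gxy).
  + by apply: Gf (Gxy'); apply: HX => //; case: (Gs _ _ Gxy').
  + exact: Hf Hxy Hxy'.
- move=> x x' y [Gxy|Hxy] [Gxy'|Hxy'].
  + exact: Gi Gxy Gxy'.
  + by apply: Gi (Gxy) _; apply: HY => //; case: (Gs _ _ Gxy).
  + by apply: Gi (Gxy'); apply: HY => //; case: (Gs _ _ Gxy').
  + exact: Hi Hxy Hxy'.
Qed.

Definition diag V W (X : set V) (f : V -> W) : set (V * W) :=
  [set z | X z.1 /\ z.2 = f z.1].

Lemma graph_linear V W (f : {linear V -> W}) : linear (fun x => (x, f x)).
Proof. by move=> a x y; rewrite linearP. Qed.

Lemma iso_linear V W (X : set V) (f : {linear V -> W}) :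
  polyhedron X -> injective f -> pl_iso X (f @` X) (diag X f).
Proof.
move=> Xp fi; split.
- pose g : {linear V -> (V * W)%type} := HB.pack (fun x : V => (x, f x))
    (GRing.isLinear.Build _ _ _ _ _ (graph_linear f)).
  rewrite (_ : diag X f = g @` X); first exact: polyhedron_image.
  apply/seteqP; split=> -[x y]; first by case=> /= Xx ->; exists x.
  by case=> x' Xx' [<- <-].
- by move=> x y [/= Xx ->]; split=> //; exists x.
- by move=> x Xx; exists (f x).
- by move=> _ [x Xx <-]; exists x.
- by move=> x y y' [/= _ ->] [/= _ ->].
- by move=> x x' y [/= _ ->] [/= _ /fi ->].
Qed.

(** The cone from c inside the ambient vector space.  For t = 1 the point y is
    arbitrary, so that the cone over the empty set is the point c. *)
Definition gcone V (c : V) (K : set V) : set V :=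
  [set z | exists t y, [/\ 0 <= t <= 1, t = 1 \/ K y &
                           z = (1 - t) *: y + t *: c]].

(** The cone from c over K is embedded: a function l recovers the height t of
    a point of the cone, and then y as well, unless t = 1
    ([joinable_uniq]). *)
Definition joinable V (c : V) (K : set V) : Prop := exists l : V -> R,
  forall t y, 0 <= t <= 1 -> t = 1 \/ K y -> l ((1 - t) *: y + t *: c) = t.

Lemma gcone_apex V (c : V) K : gcone c K c.
Proof.
by exists 1, 0; split; [rewrite ler01 lexx|left|
  rewrite subrr scale0r add0r scale1r].
Qed.

Lemma gcone_base V (c : V) K : K `<=` gcone c K.
Proof.
move=> y Ky; exists 0, y; split; [by rewrite lexx ler01|by right|].
by rewrite subr0 scale1r scale0r addr0.
Qed.

Lemma gconeS V (c : V) K L : K `<=` L -> gcone c K `<=` gcone c L.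
Proof.
move=> KL z [t [y [t01 h ->]]]; exists t, y; split=> //.
by case: h => [|/KL]; [left|right].
Qed.

Lemma conv_hull_cons V (c : V) s : conv_hull (c :: s) `<=` gcone c (conv_hull s).
Proof.
move=> x [e [e0 e1 ->]]; move: (e1); rewrite !big_ord_recl /= => e1'.
have s0 : 0 <= \sum_(i < size s) e (lift ord0 i) by apply: sumr_ge0.
set S := \sum_(i < size s) e (lift ord0 i) in e1' s0.
have t01 : 0 <= e ord0 <= 1 by rewrite e0 -e1' lerDl.
have SE : 1 - e ord0 = S by rewrite -e1' addrC addKr.
have [S0|S0] := eqVneq S 0.
  exists (e ord0), 0; split=> //.
    by left; apply/eqP; rewrite -subr_eq0 -opprB SE S0 oppr0.
  rewrite scaler0 add0r big1 ?addr0 // => i _.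
  move: S0 => /psumr_eq0P => /(_ (fun i _ => e0 _)) -> //.
  by rewrite scale0r.
exists (e ord0), (\sum_(i < size s) (e (lift ord0 i) / S) *: s`_i); split=> //.
  right; exists (fun i => e (lift ord0 i) / S); split=> //.
  - by move=> i; rewrite divr_ge0.
  - by rewrite -mulr_suml divff.
rewrite SE addrC scaler_sumr; congr (_ + _); apply: eq_bigr => i _.
by rewrite scalerA mulrC divfK.
Qed.

Lemma polyhedron_gcone V (c : V) K : polyhedron K -> polyhedron (gcone c K).
Proof.
move=> [L ->]; exists ([:: c] :: map (cons c) L); apply/seteqP; split=> z.
  move=> [t [y [t01 h ->]]]; have [->|t1] := eqVneq t 1.
    exists [:: c]; first exact: mem_head.
    rewrite subrr scale0r add0r scale1r; apply: conv_hull_mem.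
    exact: mem_head.
  case: h => [/eqP|[s /= sL sy]]; first by rewrite (negbTE t1).
  exists (c :: s); first by rewrite /= inE map_f ?orbT.
  apply: conv_hull_convex => //; last exact/conv_hull_mem/mem_head.
  by apply: conv_hull_sub sy => v vs; apply: conv_hull_mem; rewrite inE vs orbT.
move=> [s /=]; rewrite inE => /predU1P[->|/mapP[s' sL ->]].
  move=> /conv_hull_cons[t [y [t01 h ->]]]; exists t, y; split=> //.
  case: h => [|[e [_ e1 _]]]; first by left.
  by move: e1; rewrite big_ord0 => /eqP; rewrite eq_sym oner_eq0.
move=> /conv_hull_cons; apply: gconeS => y sy; by exists s'.
Qed.

Lemma joinable_uniq V (a : V) L t t' y y' : joinable a L ->
  0 <= t <= 1 -> 0 <= t' <= 1 -> t = 1 \/ L y -> t' = 1 \/ L y' ->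
  (1 - t) *: y + t *: a = (1 - t') *: y' + t' *: a ->
  t = t' /\ (t = 1 \/ y = y').
Proof.
move=> [l hl] t01 t01' Ly Ly' E.
have tt : t = t' by rewrite -(hl t y) // E hl.
split=> //; move: E; rewrite -tt => /addIr E.
have [->|t1] := eqVneq t 1; [by left|right].
by apply: scalerI E; rewrite subr_eq0 eq_sym.
Qed.

Section ConeIso.
Variables (V W : lmodType R) (c : V) (c' : W) (K : set V) (K' : set W).
Variables (G : set (V * W)).
Hypotheses (cK : joinable c K) (cK' : joinable c' K') (isoG : pl_iso K K' G).

Lemma gcone_relP x y : gcone (c, c') G (x, y) -> exists (t : R) k k',
  [/\ 0 <= t <= 1, t = 1 \/ G (k, k'),
      x = (1 - t) *: k + t *: c & y = (1 - t) *: k' + t *: c'].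
Proof. by move=> [t [[k k'] [t01 h [-> ->]]]]; exists t, k, k'. Qed.

Let GK (t : R) k k' : t = 1 \/ G (k, k') -> t = 1 \/ K k.
Proof. by case=> [|/(iso_sub isoG)[]]; [left|right]. Qed.

Let GK' (t : R) k k' : t = 1 \/ G (k, k') -> t = 1 \/ K' k'.
Proof. by case=> [|/(iso_sub isoG)[]]; [left|right]. Qed.

(** Coning off the graph from the pair of the two apexes gives the graph of
    the cone extension, because heights and base points are determined on both
    sides. *)
Lemma iso_gcone : pl_iso (gcone c K) (gcone c' K') (gcone (c, c') G).
Proof.
split.
- exact/polyhedron_gcone/(iso_poly isoG).
- move=> x y /gcone_relP[t [k [k' [t01 h -> ->]]]].
  by split; [exists t, k|exists t, k']; split=> //; [exact: GK h|exact: GK' h].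
- move=> x [t [k [t01 h ->]]]; case: h => [->|Kk].
    exists c'; rewrite subrr scale0r add0r scale1r; exact: gcone_apex.
  have [k' Gk] := iso_dom isoG Kk; exists ((1 - t) *: k' + t *: c').
  by exists t, (k, k'); split=> //; right.
- move=> y [t [k' [t01 h ->]]]; case: h => [->|Kk].
    exists c; rewrite subrr scale0r add0r scale1r; exact: gcone_apex.
  have [k Gk] := iso_cod isoG Kk; exists ((1 - t) *: k + t *: c).
  by exists t, (k, k'); split=> //; right.
- move=> x y y' /gcone_relP[t [k [k' [t01 h -> ->]]]].
  move=> /gcone_relP[u [m [m' [u01 g E ->]]]].
  have [<- km] := joinable_uniq cK t01 u01 (GK h) (GK g) E.
  have [->|t1] := eqVneq t 1; first by rewrite subrr !scale0r.
  have tn : t <> 1 by apply/eqP.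
  case: km h g => // <- [//|h] [/esym ut|g]; last by rewrite (iso_fun isoG h g).
  by have [] := joinable_uniq cK t01 u01 (or_intror (iso_sub isoG h).1)
    (or_introl (esym ut)) E => tu; rewrite tu -ut in tn.
- move=> x x' y /gcone_relP[t [k [k' [t01 h -> ->]]]].
  move=> /gcone_relP[u [m [m' [u01 g -> E]]]].
  have [tu km] := joinable_uniq cK' t01 u01 (GK' h) (GK' g) E; rewrite -tu in g *.
  have [->|t1] := eqVneq t 1; first by rewrite subrr !scale0r.
  have tn : t <> 1 by apply/eqP.
  by case: km h g => // <- [//|h] [//|g]; rewrite (iso_inj isoG h g).
Qed.

Lemma respects_gcone A B : A `<=` K -> B `<=` K' -> respects G A B ->
  respects (gcone (c, c') G) (gcone c A) (gcone c' B).
Proof.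
move=> AK BK GAB x y /gcone_relP[t [k [k' [t01 h xE yE]]]].
have [t1|t1] := eqVneq t 1.
  rewrite xE yE t1 !subrr !scale0r !add0r !scale1r.
  by split=> _; exact: gcone_apex.
have tn : t <> 1 by apply/eqP.
have G' : G (k, k') by case: h.
split=> -[u [a [u01 g E]]].
  have ga : u = 1 \/ K a by case: g => [|/AK]; [left|right].
  rewrite xE in E; have [tu ka] := joinable_uniq cK t01 u01 (GK h) ga E.
  exists t, k'; split=> //; right; apply/(GAB _ _ G').
  by case: ka g => // -> [] //; rewrite -tu.
have ga : u = 1 \/ K' a by case: g => [|/BK]; [left|right].
rewrite yE in E; have [tu ka] := joinable_uniq cK' t01 u01 (GK' h) ga E.
exists t, k; split=> //; right; apply/(GAB _ _ G').
by case: ka g => // -> [] //; rewrite -tu.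
Qed.

End ConeIso.

(** On a polytope where h is affine, the graph of h is the hull of the points
    of the graph over the vertices. *)
Lemma iso_of_homeo V W (X : set V) (Y : set W) h :
  pl_homeo X Y h -> pl_iso X Y (diag X h).
Proof.
move=> [[hXY hi hs] [K [XE ha]] _]; split.
- have gE r : r \in K -> (fun x => (x, h x)) @` conv_hull r =
      conv_hull [seq (x, h x) | x <- r].
    move=> rK; apply: conv_hull_affine => x y t rx ry t01.
    by rewrite (ha r rK).
  exists [seq [seq (v, h v) | v <- r] | r <- K].
  apply/seteqP; split=> [[x y] [/= Xx ->]|z [_ /= /mapP[r rK ->]]].
    move: Xx; rewrite XE => -[r /= rK rx].
    by exists [seq (v, h v) | v <- r]; [exact: map_f|rewrite -gE //; exists x].
  by rewrite -gE // => -[x rx <-]; split=> //=; rewrite XE; exists r.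
- by move=> x y [/= Xx ->]; split=> //; exact: hXY.
- by move=> x Xx; exists (h x).
- by move=> y /hs[x Xx <-]; exists x.
- by move=> x y y' [/= _ ->] [/= _ ->].
- move=> x x' y [/= Xx ->] [/= Xx' E]; apply: hi => //; exact/mem_set.
Qed.

(** Conversely, if the graph is a union of polytopes, then their projections
    are pieces on which h is affine: the segment between two points of the graph
    in one polytope stays in the graph. *)
Lemma pl_on_of_graph V W (X : set V) (h : V -> W) (G : set (V * W)) :
  polyhedron G -> (forall x y, G (x, y) <-> X x /\ y = h x) -> pl_on X h.
Proof.
move=> [K GE] Gh; exists (map (map fst) K).
have lift s x : s \in K -> conv_hull (map fst s) x ->
    conv_hull s (x, h x) /\ X x.
  move=> sK; rewrite -(conv_hull_image fst) => -[[x' y] sxy /= <-].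
  have : G (x', y) by rewrite GE; exists s.
  by move=> /Gh[Xx E]; rewrite -E.
split=> [|_ /mapP[s sK ->] x y t /(lift s _ sK)[sx Xx] /(lift s _ sK)[sy Xy] t01].
  apply/seteqP; split=> [x Xx|x [_ /= /mapP[s sK ->]] /(lift s _ sK)[]//].
  have : G (x, h x) by apply/Gh.
  rewrite GE => -[s /= sK sx]; exists (map fst s); first exact: map_f.
  by rewrite -(conv_hull_image fst); exists (x, h x).
have : G ((1 - t) *: (x, h x) + t *: (y, h y)).
  by rewrite GE; exists s => //; exact: conv_hull_convex.
by move=> /Gh[].
Qed.

Lemma homeo_of_iso V W (X : set V) (Y : set W) G :
  pl_iso X Y G -> exists2 h, pl_homeo X Y h & forall x, X x -> G (x, h x).
Proof.
move=> isoG; have [Gp Gs Gd Gc Gf Gi] := isoG.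
have exh x : exists y, X x -> G (x, y).
  by have [/Gd[y ?]|nX] := pselect (X x); [exists y|exists 0].
have exk y : exists x, Y y -> G (x, y).
  by have [/Gc[x ?]|nX] := pselect (Y y); [exists x|exists 0].
have [h hG] := choice exh; have [k kG] := choice exk.
have hY x : X x -> Y (h x) by move=> /hG/Gs[].
have kX y : Y y -> X (k y) by move=> /kG/Gs[].
exists h => //; split.
- split=> [x Xx|x x' /set_mem/hG Gx /set_mem/hG Gx' E|y /kG Gy].
  + exact: hY.
  + by apply: (Gi _ _ (h x)) => //; rewrite E.
  + have [Xk _] := Gs _ _ Gy; exists (k y) => //.
    exact: Gf (hG _ Xk) Gy.
- apply: (pl_on_of_graph Gp) => x y; split=> [Gxy|[/hG ? -> //]].
  by have [Xx _] := Gs _ _ Gxy; split=> //; exact: Gf Gxy (hG _ Xx).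
- exists k; split.
    by move=> x /set_mem Xx; apply: Gi (kG _ (hY _ Xx)) (hG _ Xx).
  have [Gp' _ _ _ _ _] := iso_converse isoG.
  apply: (pl_on_of_graph Gp') => y x; split=> [Gxy|[/kG ? -> //]].
  by have [_ Yy] := Gs _ _ Gxy; split=> //; exact: Gi Gxy (kG _ Yy).
Qed.

End Relations.

(** * Realizations and cones *)

Section Realization.
Context {R : realType} {d : Order.disp_t} {T : finPOrderType d}.
Implicit Types (A B : {set T}) (w : {ffun T -> R^o}).

Definition vertex (c : T) : {ffun T -> R^o} := [ffun x => (x == c)%:R].

Lemma vertex_sum w : w = \sum_x w x *: vertex x.
Proof.
apply/ffunP => y; rewrite sum_ffunE (bigD1 y) //= !ffunE eqxx.
rewrite /GRing.scale /= mulr1 big1 ?addr0 // => x xy.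
by rewrite !ffunE eq_sym (negbTE xy) scaler0.
Qed.

(** Only the support of a point decides in which subposets' realizations it
    lies; all comparisons of realizations below go through this lemma. *)
Lemma realization_weaken A B w : realization R A w ->
  (forall x, x \in A -> w x != 0 -> x \in B) -> realization R B w.
Proof. by move=> [w0 w1 wA wC] AB; split=> // x wx; apply: AB; rewrite ?wA. Qed.

Lemma realizationS A B : (A \subset B)%SET -> realization R A `<=` realization R B.
Proof.
move=> /fintype.subsetP AB w Aw; apply: realization_weaken Aw _ => x /AB //.
Qed.

Lemma realization_in A w x : realization R A w -> w x != 0 -> x \in A.
Proof. by case=> _ _ + _; apply. Qed.

Lemma realization_supp A w : realization R A w -> exists2 x, x \in A & w x != 0.
Proof.
move=> Aw; have [w0 w1 _ _] := Aw.
have [x wx|w0'] := pickP (fun x => w x != 0).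
  by exists x => //; apply: realization_in wx.
move: w1; rewrite big1 => [/esym/eqP|x _]; first by rewrite oner_eq0.
by have /negbFE/eqP := w0' x.
Qed.

Lemma realization_set0 A w : A = finset.set0 -> ~ realization R A w.
Proof. by move=> -> /realization_supp[x]; rewrite inE. Qed.

(** The polytopes are the simplices spanned by the chains. *)
Lemma polyhedron_realization A : polyhedron (realization R A).
Proof.
pose chain (C : {set T}) := (C \subset A)%SET &&
  [forall x in C, forall y in C, (x >=< y)%O].
exists [seq [seq vertex x | x <- enum C] | C : {set T} <- enum chain].
apply/seteqP; split=> w.
  move=> Aw; have [w0 w1 _ wC] := Aw; pose C := [set x | w x != 0]%SET.
  exists [seq vertex x | x <- enum C].
    apply: map_f; rewrite mem_enum; apply/andP; split.
      apply/fintype.subsetP => x; rewrite inE; exact: realization_in.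
    apply/forall_inP => x; rewrite inE => wx; apply/forall_inP => y.
    by rewrite inE; exact: wC.
  rewrite (vertex_sum w); apply: conv_hull_comb => // x wx; apply: conv_hull_mem.
  by apply: map_f; rewrite mem_enum inE.
move=> [_ /= /mapP[C CC ->]]; move: CC; rewrite mem_enum => /andP[CA /forall_inP CC].
move=> [e [e0 e1 ->]]; set s := map _ _.
have vs (i : 'I_(size s)) : exists2 x, x \in C & s`_i = vertex x.
  have /mapP[x] : s`_i \in s by rewrite mem_nth.
  by rewrite mem_enum => xC ->; exists x.
have nz x : (\sum_i e i *: s`_i) x != 0 -> x \in C.
  apply: contraR => xC; rewrite sum_ffunE big1 // => i _.
  have [y yC ->] := vs i; rewrite !ffunE; case: eqP => [xy|_].
    by rewrite xy yC in xC.
  by rewrite /GRing.scale /= mulr0.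
split.
- move=> x; rewrite sum_ffunE; apply: sumr_ge0 => i _.
  have [y yC ->] := vs i; by rewrite !ffunE; apply: mulr_ge0 => //.
- under eq_bigr do rewrite sum_ffunE.
  rewrite exchange_big /= -e1; apply: eq_bigr => i _.
  have [y yC ->] := vs i; rewrite (bigD1 y) //= !ffunE eqxx.
  rewrite /GRing.scale /= mulr1 big1 ?addr0 // => x /negbTE xy.
  by rewrite !ffunE xy scaler0.
- by move=> x /nz; move/fintype.subsetP: CA; apply.
- by move=> x y /nz xC /nz yC; have /forall_inP := CC _ xC; apply.
Qed.

Lemma joinable_vertex c A : c \notin A -> joinable (vertex c) (realization R A).
Proof.
move=> cA; exists (fun w => w c) => t y _ h; rewrite !ffunE eqxx.
rewrite /GRing.scale /= mulr1; case: h => [->|Ay].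
  by rewrite subrr mul0r add0r.
have -> : y c = 0 by apply/eqP; apply: contraNT cA; exact: realization_in.
by rewrite mulr0 add0r.
Qed.

Lemma realization_setU1 c A : c \notin A -> (forall x, x \in A -> (x >=< c)%O) ->
  realization R (c |: A)%SET = gcone (vertex c) (realization R A).
Proof.
move=> cA Ac; apply/seteqP; split=> w.
  move=> [w0 w1 wA wC]; have := w1; rewrite (bigD1 c) //= => w1'.
  have s0 : 0 <= \sum_(x | x != c) w x by apply: sumr_ge0.
  have t1 : w c <= 1 by rewrite -w1' lerDl.
  have sE : \sum_(x | x != c) w x = 1 - w c by rewrite -w1' [w c + _]addrC addrK.
  have t01 : 0 <= w c <= 1 by rewrite w0.
  have [wc|wc] := eqVneq (w c) 1.
    exists 1, 0; split; [by rewrite ler01 lexx|by left|].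
    rewrite subrr scale0r add0r scale1r; apply/ffunP => x; rewrite !ffunE.
    case: eqP => [->//|/eqP xc]; move: sE; rewrite wc subrr => sE.
    by rewrite (psumr_eq0P (fun x _ => w0 x) sE xc).
  have d0 : 1 - w c != 0 by rewrite subr_eq0 eq_sym.
  pose y := [ffun x => if x == c then 0 else w x / (1 - w c)] : {ffun T -> R^o}.
  have yw x : y x != 0 -> x != c /\ w x != 0.
    rewrite ffunE; case: (x =P c) => [_|_]; first by rewrite eqxx.
    by rewrite mulf_eq0 negb_or => /andP[].
  exists (w c), y; split=> //.
    right; split.
    - move=> x; rewrite ffunE; case: ifP => // _.
      by rewrite divr_ge0 // subr_ge0.
    - rewrite (bigD1 c) //= ffunE eqxx add0r.
      rewrite (eq_bigr (fun x => w x / (1 - w c))) => [|x /negbTE xc].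
        by rewrite -mulr_suml sE divff.
      by rewrite ffunE xc.
    - by move=> x /yw[/negbTE xc /wA]; rewrite finset.in_setU1 xc.
    - by move=> x x' /yw[_ wx] /yw[_ wx']; exact: wC.
  apply/ffunP => x; rewrite !ffunE /GRing.scale /=.
  case: (x =P c) => [->|_]; first by rewrite mulr0 add0r mulr1.
  by rewrite mulr0 addr0 mulrC divfK.
move=> [t [y [/andP[t0 t1] h ->]]].
have [tE|tn] := eqVneq t 1.
  rewrite tE subrr scale0r add0r scale1r.
  have vn x : vertex c x != 0 -> x = c.
    by apply: contraNeq => /negbTE xc; rewrite ffunE xc.
  split.
  - by move=> x; rewrite ffunE ler0n.
  - by rewrite (bigD1 c) //= ffunE eqxx big1 ?addr0 // => x /negbTE; rewrite ffunE => ->.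
  - by move=> x /vn ->; rewrite finset.setU11.
  - by move=> x x' /vn -> /vn ->; rewrite comparablexx.
have [y0 y1 yA yC] : realization R A y by case: h => [/eqP|//]; rewrite (negbTE tn).
have nz x : ((1 - t) *: y + t *: vertex c) x != 0 -> x = c \/ y x != 0.
  rewrite !ffunE /GRing.scale /=; case: (x =P c) => [|_]; first by left.
  by rewrite /= mulr0 addr0 mulf_eq0 negb_or => /andP[_ ?]; right.
split.
- move=> x; rewrite !ffunE addr_ge0 //; apply: mulr_ge0 => //.
  by rewrite subr_ge0.
- under eq_bigr do rewrite !ffunE /GRing.scale /=.
  rewrite big_split /= -!mulr_sumr y1 mulr1 (bigD1 c) //= eqxx.
  rewrite big1 ?addr0 ?mulr1 ?subrK // => x /negbTE -> //.
- by move=> x /nz[->|/yA xA]; rewrite finset.in_setU1 ?eqxx ?xA ?orbT.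
- move=> x x' /nz[->|yx] /nz[->|yx'].
  + exact: comparablexx.
  + by rewrite comparable_sym Ac // yA.
  + by rewrite Ac // yA.
  + exact: yC.
Qed.

Lemma cone_base_linear : linear (@cone_base R d T).
Proof.
move=> a x y; apply/ffunP => -[z|]; rewrite !ffunE /GRing.scale /=.
  by rewrite subr0 !mul1r.
by rewrite mulr0 addr0.
Qed.

HB.instance Definition _ := GRing.isLinear.Build _ _ _ _ _ cone_base_linear.

Lemma cone_base_inj : injective (@cone_base R d T).
Proof.
move=> x y /ffunP E; apply/ffunP => z; have := E (Some z).
by rewrite !ffunE subr0 !mul1r.
Qed.

Lemma cone_ptE t (y : {ffun T -> R^o}) :
  cone_pt t y = (1 - t) *: cone_base y + t *: @cone_apex R d T.
Proof.
apply/ffunP => -[z|]; rewrite !ffunE /GRing.scale /=.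
  by rewrite subr0 mul1r subrr mul0r mulr0 addr0.
by rewrite mulr0 add0r mulr1.
Qed.

Lemma coneE (Y : set {ffun T -> R^o}) :
  cone Y = gcone (@cone_apex R d T) (cone_base @` Y).
Proof.
apply/seteqP; split=> z.
  case=> [->|[t [y [t01 Yy ->]]]]; first exact: gcone_apex.
  exists t, (cone_base y); rewrite cone_ptE; split=> //; right.
  by exists y.
move=> [t [y [t01 h ->]]].
have [->|tn] := eqVneq t 1.
  by left; rewrite subrr scale0r add0r scale1r.
case: h => [/eqP|[x Yx <-]]; first by rewrite (negbTE tn).
by right; exists t, x; rewrite cone_ptE.
Qed.

Lemma joinable_apex (Y : set {ffun T -> R^o}) :
  joinable (@cone_apex R d T) (cone_base @` Y).
Proof.
exists (fun z : {ffun cone_poset T -> R^o} => z None) => t y _ h.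
rewrite !ffunE /GRing.scale /= mulr1.
case: h => [->|[x _ <-]]; first by rewrite subrr mul0r add0r.
by rewrite ffunE mulr0 add0r.
Qed.

End Realization.
Arguments vertex {R d T} c.

Section CoordForm.
Context {R : realType}.
Variables (I : finType) (i : I).

Definition coord (w : {ffun I -> R^o}) : R^o := w i.

Lemma coord_linear : linear coord.
Proof. by move=> a x y; rewrite /coord !ffunE. Qed.

HB.instance Definition _ := GRing.isLinear.Build _ _ _ _ _ coord_linear.

End CoordForm.

(** ** The cone over a suspension

    The functionals [l1] and [l2] witness that W, a1 and a2 are in general
    position: l1 and l2 are the barycentric coordinates at a1 and a2 in the join
    of W with the segment from a1 to a2. *)

Section DoubleCone.
Context {R : realType} (V : lmodType R) (l1 l2 : {linear V -> R^o}).
Variables (a1 a2 : V) (W : set V).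
Hypotheses (l1W : forall w, W w -> l1 w = 0) (l2W : forall w, W w -> l2 w = 0).
Hypotheses (l11 : l1 a1 = 1) (l12 : l1 a2 = 0) (l21 : l2 a1 = 0) (l22 : l2 a2 = 1).

Let c : V := (1 / 2) *: a1 + (1 / 2) *: a2.
Let K := gcone a1 W `|` gcone a2 W.

Lemma joinable_a1 : joinable a1 W.
Proof.
exists l1 => t y _ h; rewrite linearD !linearZ /= l11 /GRing.scale /= mulr1.
by case: h => [->|/l1W ->]; rewrite ?subrr ?mul0r ?mulr0 add0r.
Qed.

Lemma joinable_a2 : joinable a2 W.
Proof.
exists l2 => t y _ h; rewrite linearD !linearZ /= l22 /GRing.scale /= mulr1.
by case: h => [->|/l2W ->]; rewrite ?subrr ?mul0r ?mulr0 add0r.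
Qed.

Lemma joinable_a2_cone : joinable a2 (gcone a1 W).
Proof.
exists l2 => t y _ h; rewrite linearD !linearZ /= l22 /GRing.scale /= mulr1.
case: h => [->|[u [w [_ h ->]]]]; first by rewrite subrr mul0r add0r.
rewrite linearD !linearZ /= l21 /GRing.scale /= mulr0 addr0.
by case: h => [->|/l2W ->]; rewrite ?subrr ?mul0r ?mulr0 add0r.
Qed.

Lemma cones_meet z : gcone a1 W z -> gcone a2 W z -> W z.
Proof.
move=> [t [w [t01 h zE]]] [u [w' [u01 h' zE']]].
have : l1 z = t.
  rewrite zE linearD !linearZ /= l11 /GRing.scale /= mulr1.
  by case: h => [->|/l1W ->]; rewrite ?subrr ?mul0r ?mulr0 add0r.
have -> : l1 z = 0.
  rewrite zE' linearD !linearZ /= l12 /GRing.scale /= mulr0 addr0.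
  by case: h' => [->|/l1W ->]; rewrite ?subrr ?mul0r ?mulr0.
move=> t0; rewrite -t0 in h zE; case: h => [/esym/eqP|].
  by rewrite oner_eq0.
by rewrite zE subr0 scale1r scale0r addr0.
Qed.

(** A point of the suspension K has one of the two coordinates l1, l2 equal to
    0 and the other nonnegative, while both are 1/2 at the midpoint c.  So twice
    the smaller coordinate is the height over K. *)
Lemma joinable_mid : joinable c K.
Proof.
exists (fun z => 2 * Num.min (l1 z) (l2 z)) => t y /andP[t0 t1] h.
rewrite /c /= !linearD !linearZ /= l11 l12 l21 l22.
rewrite /GRing.scale /= !mulr1 !mulr0 addr0 add0r.
have [->|[y1 y2]] : t = 1 \/ 0 <= l1 y /\ 0 <= l2 y /\ Num.min (l1 y) (l2 y) = 0.
  case: h => [|Ky]; [by left|right]; case: Ky => -[u [w [/andP[u0 u1] h ->]]].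
    rewrite !linearD !linearZ /= l11 l21 /GRing.scale /= mulr1 mulr0 addr0.
    have [-> ->] : (1 - u) * l1 w = 0 /\ (1 - u) * l2 w = 0.
      case: h => [->|Ww]; first by rewrite subrr !mul0r.
      by rewrite l1W // l2W // mulr0.
    by rewrite add0r; split=> //; split=> //; rewrite min_r.
  rewrite !linearD !linearZ /= l12 l22 /GRing.scale /= mulr1 mulr0 addr0.
  have [-> ->] : (1 - u) * l1 w = 0 /\ (1 - u) * l2 w = 0.
    case: h => [->|Ww]; first by rewrite subrr !mul0r.
    by rewrite l1W // l2W // mulr0.
  by rewrite add0r; split=> //; split=> //; rewrite min_l.
  by rewrite subrr !mul0r !add0r minxx; field.
case: y2 => y2 m.
rewrite -addr_minl // -[in LHS]minr_pMr ?subr_ge0 // m mulr0 add0r; by field.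
Qed.

(* The allowance p = 0 covers an empty W. *)
Let join : set V := [set z | exists p q r w,
  [/\ [/\ 0 <= p, 0 <= q & 0 <= r], p + q + r = 1, p = 0 \/ W w &
      z = p *: w + q *: a1 + r *: a2]].

Let gcone_scale (a : V) p q w : 0 <= p -> 0 <= q -> p + q != 0 ->
  p = 0 \/ W w ->
  exists2 y, gcone a W y & p *: w + q *: a = (p + q) *: y.
Proof.
move=> p0 q0 pq h; have dp : 0 < p + q by rewrite lt_def pq; lra.
have E : (1 - q / (p + q)) = p / (p + q) by field.
exists ((1 - q / (p + q)) *: w + (q / (p + q)) *: a).
  exists (q / (p + q)), w; split=> //.
    apply/andP; split; first by rewrite divr_ge0 // ltW.
    by rewrite ler_pdivrMr // mul1r; lra.
  case: h => [pE|]; [left|by right].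
  by move: E; rewrite pE mul0r => /eqP; rewrite subr_eq0 => /eqP.
by rewrite E scalerDr !scalerA !(mulrC (p + q)) !divfK.
Qed.

Let gcone_join1 : gcone a2 (gcone a1 W) = join.
Proof.
apply/seteqP; split=> z.
  move=> [t [y [/andP[t0 t1] h ->]]].
  have [tE|tn] := eqVneq t 1.
    exists 0, 0, 1, 0; rewrite tE subrr !scale0r !add0r.
    by split=> //; left.
  case: h => [/eqP|]; first by rewrite (negbTE tn).
  move=> [u [w [/andP[u0 u1] h ->]]].
  exists ((1 - t) * (1 - u)), ((1 - t) * u), t, w; split.
  - by split=> //; apply: mulr_ge0; rewrite ?subr_ge0.
  - by ring.
  - by case: h => [->|]; [left; rewrite subrr mulr0|right].
  - by rewrite scalerDr !scalerA.
move=> [p [q [r [w [[p0 q0 r0] pqr h ->]]]]].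
have [rE|rn] := eqVneq r 1.
  exists 1, 0; split; [by rewrite ler01 lexx|by left|].
  have -> : p = 0 by lra.
  have -> : q = 0 by lra.
  by rewrite rE subrr !scale0r !add0r.
have d0 : p + q != 0 by apply: contra rn => /eqP ?; apply/eqP; lra.
have [y Wy yE] := gcone_scale a1 p0 q0 d0 h.
exists r, y; split; [by apply/andP; split; lra|by right|].
by rewrite yE; congr (_ *: _ + _); lra.
Qed.

Let gcone_join2 : gcone c K = join.
Proof.
apply/seteqP; split=> z.
  move=> [t [y [/andP[t0 t1] h ->]]].
  have [tE|tn] := eqVneq t 1.
    exists 0, (1 / 2), (1 / 2), 0; rewrite tE subrr !scale0r !add0r scale1r.
    by split=> //; [split=> //; lra|lra|left].
  case: h => [/eqP|]; first by rewrite (negbTE tn).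
  rewrite /c scalerDr !scalerA.
  case=> -[u [w [/andP[u0 u1] h ->]]]; rewrite scalerDr !scalerA.
    exists ((1 - t) * (1 - u)), ((1 - t) * u + t * (1 / 2)), (t * (1 / 2)), w.
    have ? : 0 <= (1 - t) * u by apply: mulr_ge0; rewrite ?subr_ge0.
    split.
    - by split; [apply: mulr_ge0; rewrite ?subr_ge0|lra|lra].
    - by field.
    - by case: h => [->|]; [left; rewrite subrr mulr0|right].
    - by rewrite [in RHS]scalerDl !addrA.
  exists ((1 - t) * (1 - u)), (t * (1 / 2)), ((1 - t) * u + t * (1 / 2)), w.
  have ? : 0 <= (1 - t) * u by apply: mulr_ge0; rewrite ?subr_ge0.
  split.
  - by split; [apply: mulr_ge0; rewrite ?subr_ge0|lra|lra].
  - by field.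
  - by case: h => [->|]; [left; rewrite subrr mulr0|right].
  - by rewrite [in RHS]scalerDl -!addrA; congr (_ + _); rewrite addrCA.
move=> [p [q [r [w [[p0 q0 r0] pqr h ->]]]]].
have [pE|pn] := eqVneq (p + `|q - r|) 0.
  have qr0 : 0 <= `|q - r| by [].
  have : `|q - r| = 0 by lra.
  move=> /eqP; rewrite normr_eq0 => /eqP qr.
  have -> : p = 0 by lra.
  have -> : q = 1 / 2 by lra.
  have -> : r = 1 / 2 by lra.
  by rewrite scale0r add0r; exact: gcone_apex.
have [rq|qr] := leP r q.
  rewrite ger0_norm ?subr_ge0 // in pn.
  have [|y Wy yE] := gcone_scale a1 p0 _ pn h; first by rewrite subr_ge0.
  (* The smaller of q and r goes to the midpoint, with weight 2 r. *)
  exists (2 * r), y; split; [by apply/andP; split; lra|by right; left|].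
  have -> : 1 - 2 * r = p + (q - r) by lra.
  rewrite -yE /c scalerDr !scalerA -addrA -[in RHS]addrA; congr (_ + _).
  by rewrite addrA -scalerDl; congr (_ *: _ + _ *: _); field.
rewrite ltr0_norm ?subr_lt0 // in pn.
have [|y Wy yE] := gcone_scale a2 p0 _ pn h; first by rewrite oppr_ge0 subr_le0 ltW.
exists (2 * q), y; split; [by apply/andP; split; lra|by right; right|].
have -> : 1 - 2 * q = p + - (q - r) by lra.
rewrite -yE /c scalerDr !scalerA -addrA -[in RHS]addrA; congr (_ + _).
by rewrite addrCA -scalerDl; congr (_ *: _ + _ *: _); field.
Qed.

(** Both sides are the join of W with the segment from a1 to a2. *)
Lemma double_cone : gcone c K = gcone a2 (gcone a1 W).
Proof. by rewrite gcone_join1 gcone_join2. Qed.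

End DoubleCone.

(** ** Extending a homeomorphism over an abstract cone *)

Section ConeExt.
Context {R : realType} {d : Order.disp_t} {T : finPOrderType d}.

Lemma coneS (A B : set {ffun T -> R^o}) : A `<=` B -> cone A `<=` cone B.
Proof. by move=> AB; rewrite !coneE; apply/gconeS/image_subset. Qed.

Lemma cone_meet (A B : set {ffun T -> R^o}) z :
  cone A z -> cone B z -> cone (A `&` B) z.
Proof.
rewrite !coneE => -[t [y [t01 h zE]]] [u [y' [u01 h' zE']]].
have Ly (s : R) (C : set {ffun T -> R^o}) v : s = 1 \/ (cone_base @` C) v ->
    s = 1 \/ (cone_base @` [set: {ffun T -> R^o}]) v.
  by case=> [|[w _ <-]]; [left|right; exists w].
have [tu] := joinable_uniq (joinable_apex setT) t01 u01 (Ly _ _ _ h)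
  (Ly _ _ _ h') (etrans (esym zE) zE').
have [t1 _|tn] := eqVneq t 1; first by exists t, y; split=> //; left.
case=> [/eqP|yy]; first by rewrite (negbTE tn).
exists t, y; split=> //; right.
case: h => [/eqP|[w Aw wE]]; first by rewrite (negbTE tn).
rewrite -tu in h'; case: h' => [/eqP|[w' Bw wE']]; first by rewrite (negbTE tn).
exists w => //; split=> //.
by rewrite (_ : w = w') //; apply: (@cone_base_inj R d T); rewrite wE wE'.
Qed.

Lemma coneU (A B : set {ffun T -> R^o}) : cone (A `|` B) = cone A `|` cone B.
Proof.
apply/seteqP; split=> z; last by case; apply: coneS => y; [left|right].
case=> [->|[t [y [t01 [Ay|By] ->]]]]; first by left; left.
  by left; right; exists t, y.
by right; right; exists t, y.
Qed.

Variables (W : lmodType R) (Z Y0 : set {ffun T -> R^o}) (K : set W) (c : W).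
Variables (H : set ({ffun T -> R^o} * {ffun cone_poset T -> R^o})).
Variable (G : set ({ffun T -> R^o} * W)).
Hypotheses (isoH : pl_iso Z (cone Y0) H)
  (Hbase : forall y, Y0 y -> H (y, cone_base y))
  (pY0 : polyhedron Y0) (isoG : pl_iso Y0 K G) (cK : joinable c K).

(** If H identifies Z with the abstract cone over Y0, rel Y0, then any
    homeomorphism G from Y0 to the base of a geometric cone extends to a
    homeomorphism from Z to that cone: first apply H, then the cone over G. *)
Definition cone_ext : set ({ffun T -> R^o} * W) :=
  rcomp H (gcone (@cone_apex R d T, c)
             (rcomp (converse (diag Y0 (@cone_base R d T))) G)).

Let isoB : pl_iso (cone_base @` Y0) K
  (rcomp (converse (diag Y0 (@cone_base R d T))) G).
Proof.
apply: iso_comp isoG; apply: iso_converse; apply: iso_linear => //.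
exact: cone_base_inj.
Qed.

Let isoC : pl_iso (cone Y0) (gcone c K)
  (gcone (@cone_apex R d T, c)
             (rcomp (converse (diag Y0 (@cone_base R d T))) G)).
Proof. by rewrite coneE; apply: iso_gcone => //; exact: joinable_apex. Qed.

Lemma cone_ext_iso : pl_iso Z (gcone c K) cone_ext.
Proof. exact: iso_comp isoH isoC. Qed.

Lemma cone_ext_sub x y : G (x, y) -> cone_ext (x, y).
Proof.
move=> Gxy; have [Yx _] := iso_sub isoG Gxy.
exists (cone_base x); first exact: Hbase.
by apply: gcone_base; exists x.
Qed.

Lemma cone_ext_dom x y : cone_ext (x, y) -> Y0 x -> G (x, y).
Proof.
move=> Exy Yx; have [y' Gxy'] := iso_dom isoG Yx.
by rewrite (iso_fun cone_ext_iso Exy (cone_ext_sub Gxy')).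
Qed.

Lemma cone_ext_cod x y : cone_ext (x, y) -> K y -> G (x, y).
Proof.
move=> Exy Ky; have [x' Gxy'] := iso_cod isoG Ky.
by rewrite (iso_inj cone_ext_iso Exy (cone_ext_sub Gxy')).
Qed.

Lemma cone_ext_respects A B C : C `<=` Y0 -> B `<=` K ->
  respects H A (cone C) -> respects G C B -> respects cone_ext A (gcone c B).
Proof.
move=> CY BK HAC GCB; apply: respects_comp HAC _; rewrite coneE.
apply: (respects_gcone (joinable_apex _) cK isoB) => //.
  exact: image_subset.
apply: respects_comp GCB => _ x [/= Yx ->].
by split=> [[x' Cx' /cone_base_inj <-]|] //; exists x.
Qed.

End ConeExt.

(** * The cone structure over the link of a point

    The pullback enters only through its points: [p] and [t] are the two
    coordinates on its dual [T], which is all the pairs (p, t) with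
    alpha p <= t, with the order of [leT]. *)

Section Main.
Context {R : realType} {dP dQ d : Order.disp_t} {P : finPOrderType dP}
  {Q : finPOrderType dQ} {T : finPOrderType d}.
Variables (alpha : P -> Q) (p : T -> P) (t : T -> Q).
Hypothesis alpha_mono : monotone_map alpha.
Hypothesis leT : forall x y : T, (x <= y)%O = (p y <= p x)%O && (t x <= t y)%O.
Hypothesis alpha_le : forall x, (alpha (p x) <= t x)%O.
Hypothesis pt_exists : forall a q, (alpha a <= q)%O -> exists x, p x = a /\ t x = q.
Hypothesis strat : forall q a, (alpha a < q)%O ->
  exists h : {ffun P -> R^o} -> {ffun cone_poset P -> R^o},
    pl_homeo (realization R [set x | (a < x)%O && (alpha x <= q)%O]%SET)
             (cone (realization R [set x | (a < x)%O && (alpha x < q)%O]%SET)) h /\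
    {in realization R [set x | (a < x)%O && (alpha x < q)%O]%SET, h =1 cone_base}.

Definition dual_star a (B : {set Q}) : {set T} :=
  [set x | (a <= p x)%O && (t x \in B)]%SET.
Definition dual_link a (B : {set Q}) : {set T} :=
  [set x | (a < p x)%O && (t x \in B)]%SET.
Definition lower (B : {set Q}) := forall x y, y \in B -> (x <= y)%O -> x \in B.
Definition upper (U : {set P}) := forall x y, x \in U -> (x <= y)%O -> y \in U.

Local Notation "<| A |>" := (realization R A%SET)
  (at level 0, A at level 99, format "<| A |>").

(** A single homeomorphism has to serve all lower sets [B'] at once: the
    induction restricts it to some of them, and the fibrewise condition of the
    theorem concerns the principal ones. *)
Definition coning a B := exists G : set ({ffun T -> R^o} * {ffun cone_poset T -> R^o}),
  [/\ pl_iso <|dual_star a B|> (cone <|dual_link a B|>) G,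
      forall y, <|dual_link a B|> y -> G (y, cone_base y) &
      forall B', lower B' -> alpha a \in B' ->
        respects G <|dual_star a B'|> (cone <|dual_link a B'|>)].

Lemma lower_down q : lower (down_set q).
Proof. by move=> x y; rewrite !inE => /[swap]; exact: le_trans. Qed.

Lemma lower_bd_down q : lower (bd_down_set q).
Proof. by move=> x y; rewrite !inE => /[swap]; exact: le_lt_trans. Qed.

Lemma dual_link_star a B : <|dual_link a B|> `<=` <|dual_star a B|>.
Proof.
by apply: realizationS; apply/fintype.subsetP => x; rewrite !inE => /andP[/ltW -> ->].
Qed.

Lemma dual_starS a (B B' : {set Q}) :
  (B \subset B')%SET -> <|dual_star a B|> `<=` <|dual_star a B'|>.
Proof.
move=> /fintype.subsetP BB; apply: realizationS; apply/fintype.subsetP => x.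
by rewrite !inE => /andP[-> /BB ->].
Qed.

Lemma dual_linkS a (B B' : {set Q}) :
  (B \subset B')%SET -> <|dual_link a B|> `<=` <|dual_link a B'|>.
Proof.
move=> /fintype.subsetP BB; apply: realizationS; apply/fintype.subsetP => x.
by rewrite !inE => /andP[-> /BB ->].
Qed.

Section Flatten.
Variable q : Q.

Definition over_part (U : {set P}) : {set T} := [set x | (p x \in U) && (t x <= q)%O]%SET.

(** The projection [p] from the part of [T] over [U] with t <= q to [U] is
    replaced by a PL homeomorphism.  It is compatible with the projection only
    up to upper sets, which is what allows it to be extended one vertex of [U]
    at a time; the last clause matches the part t < q with the part
    alpha < q. *)
Definition flattening U := exists G : set ({ffun T -> R^o} * {ffun P -> R^o}),
  [/\ pl_iso <|over_part U|> <|U|> G,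
      forall U', upper U' -> respects G <|[set x | p x \in U']|> <|U'|> &
      respects G <|[set x | (t x < q)%O]|> <|[set x | (alpha x < q)%O]|>].

(** *** Adding a minimal point to the flattened set *)

Section Step.
Variables (U0 : {set P}) (m : P).
Hypotheses (mU : m \notin U0) (U0m : forall x, x \in U0 -> ~~ (x <= m)%O)
  (U0up : forall x y, x \in m |: U0 -> (x <= y)%O -> (alpha y <= q)%O ->
     y \in m |: U0).
Hypotheses (coning_m : coning m (down_set q)) (flat0 : flattening U0).

Let V : {set P} := [set x in U0 | (m < x)%O]%SET.

Let inV x : (m < x)%O -> (alpha x <= q)%O -> x \in V.
Proof.
move=> mx xq; rewrite inE mx andbT.
have := U0up (finset.setU11 m U0) (ltW mx) xq.
by rewrite finset.in_setU1 gt_eqF.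
Qed.

Let over_partU w :
  <|over_part (m |: U0)|> w <-> <|over_part U0|> w \/ <|dual_star m (down_set q)|> w.
Proof.
split=> [Mw|[]]; first last.
- apply: realizationS; apply/fintype.subsetP => x; rewrite !inE => /andP[mx tx].
  rewrite tx andbT.
  have := U0up (finset.setU11 m U0) mx (le_trans (alpha_le x) tx).
  by rewrite finset.in_setU1.
- apply: realizationS; apply/fintype.subsetP => x; rewrite !inE => /andP[-> ->].
  by rewrite orbT.
have [/existsP[x /andP[wx /eqP px]]|nx] := boolP [exists x, (w x != 0) && (p x == m)].
  right; apply: realization_weaken (Mw) _ => y; rewrite !inE => /andP[yU ->] wy.
  rewrite andbT; case/predU1P: yU => [->//|yU].
  have [_ _ _ wC] := Mw; have := wC x y wx wy.
  rewrite /Order.comparable !leT px => /orP[/andP[ym _]|/andP[] //].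
  by have := U0m yU; rewrite ym.
left; apply: realization_weaken (Mw) _ => y; rewrite !inE => /andP[yU ->] wy.
rewrite andbT; case/predU1P: yU => // ym.
by case/existsP: nx; exists y; rewrite wy ym eqxx.
Qed.

Let UsetU w : <|m |: U0|> w <-> <|U0|> w \/ <|m |: V|> w.
Proof.
split=> [Uw|[]]; first last.
- apply: realizationS; apply/fintype.subsetP => x; rewrite !inE.
  by case/predU1P => [->|/andP[->]]; rewrite ?eqxx ?orbT.
- by apply: realizationS; apply/fintype.subsetP => x; rewrite !inE => ->; rewrite orbT.
have [wm|wm] := eqVneq (w m) 0.
  left; apply: realization_weaken (Uw) _ => x; rewrite !inE => /predU1P[->|//].
  by rewrite wm eqxx.
right; apply: realization_weaken (Uw) _ => x; rewrite !inE.
case/predU1P => [->|xU wx]; first by rewrite eqxx.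
have [_ _ _ wC] := Uw; have := wC _ _ wx wm.
rewrite /Order.comparable (negbTE (U0m xU)) /= => mx.
rewrite xU lt_def mx andbT /=; case: eqP => [xm|] //.
Qed.

(** Adding the minimal element m to U0 adds to |U0| the cone from m over the
    link V of m, and adds to the part over U0 the realization of the dual star
    of m over {t <= q}, which is a cone over the corresponding dual link.  Since
    the flattening of U0 already matches this dual link with V, it extends over
    the two cones. *)
Lemma flattening_step : flattening (m |: U0).
Proof.
have [G [isoG Gup Gq]] := flat0; have [H [isoH Hbase HB]] := coning_m.
have Vm : m \notin V by rewrite inE ltxx andbF.
have YM : <|dual_link m (down_set q)|> `<=` <|over_part U0|>.
  apply: realizationS; apply/fintype.subsetP => x; rewrite !inE => /andP[mx tx].
  by have := inV mx (le_trans (alpha_le x) tx); rewrite inE tx => /andP[->].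
have VU : <|V|> `<=` <|U0|>.
  by apply: realizationS; apply/fintype.subsetP => x; rewrite inE => /andP[].
have resV : respects G <|dual_link m (down_set q)|> <|V|>.
  move=> x y Gxy; have [Mx Uy] := iso_sub isoG Gxy.
  have up_gt : upper [set x | (m < x)%O]%SET.
    by move=> u v; rewrite !inE; exact: lt_le_trans.
  have := Gup _ up_gt _ _ Gxy => -[h1 h2]; split=> [Yx|Vy].
    apply: realization_weaken (Uy) _ => u uU yu.
    have : u \in [set x | (m < x)%O]%SET.
      apply: realization_in yu; apply: h1.
      by apply: realization_weaken (Yx) _ => v; rewrite !inE => /andP[].
    by rewrite !inE uU.
  apply: realization_weaken (Mx) _ => u; rewrite !inE => /andP[_ ->] xu.
  have : u \in [set x | p x \in [set x | (m < x)%O]]%SET.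
    apply: realization_in xu; apply: h2.
    by apply: realization_weaken (Vy) _ => v; rewrite !inE => /andP[].
  by rewrite !inE => ->.
pose G1 := restr G <|dual_link m (down_set q)|>.
have isoG1 : pl_iso <|dual_link m (down_set q)|> <|V|> G1.
  exact: iso_restr isoG resV (polyhedron_realization _) YM VU.
have jV : joinable (vertex m) <|V|> by exact: joinable_vertex.
pose E := cone_ext <|dual_link m (down_set q)|> (vertex m) H G1.
have isoE : pl_iso <|dual_star m (down_set q)|> <|m |: V|> E.
  rewrite realization_setU1 //; last first.
    by move=> x; rewrite inE => /andP[_ /ltW mx]; rewrite /Order.comparable mx orbT.
  by apply: cone_ext_iso => //; exact: polyhedron_realization.
have pY := @polyhedron_realization R _ _ (dual_link m (down_set q)).
have EdomG x y : E (x, y) -> <|dual_link m (down_set q)|> x -> G (x, y).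
  by move=> Exy Yx; have [] := cone_ext_dom isoH Hbase pY isoG1 jV Exy Yx.
have EcodG x y : E (x, y) -> <|V|> y -> G (x, y).
  by move=> Exy Vy; have [] := cone_ext_cod isoH Hbase pY isoG1 jV Exy Vy.
(* A point of the new part that avoids the fibre of m lies in the old part. *)
have offZ x : <|dual_star m (down_set q)|> x -> (forall u, x u != 0 -> p u != m) ->
    <|dual_link m (down_set q)|> x.
  move=> Zx xm; apply: realization_weaken (Zx) _ => u; rewrite !inE => /andP[mu ->] xu.
  by rewrite andbT lt_def mu andbT xm.
have offV y : <|m |: V|> y -> y m = 0 -> <|V|> y.
  move=> Vy ym; apply: realization_weaken (Vy) _ => u; rewrite finset.in_setU1.
  by case/predU1P => [->|//]; rewrite ym eqxx.
exists (G `|` E); split.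
- have -> : <|over_part (m |: U0)|> = <|over_part U0|> `|` <|dual_star m (down_set q)|>.
    by apply/seteqP; split=> w /over_partU.
  have -> : <|m |: U0|> = <|U0|> `|` <|m |: V|> by apply/seteqP; split=> w /UsetU.
  apply: iso_glue => // x y Exy; have [Zx Vy] := iso_sub isoE Exy => h.
    apply: EdomG => //; apply: offZ => // u xu.
    have := realization_in h xu; rewrite inE => /andP[pu _].
    by apply: contraNneq mU => <-.
  apply: EcodG => //; apply: offV => //; apply/eqP; apply: contraNT mU.
  exact: realization_in h.
- move=> U' up' x y [/Gup|Exy]; first exact.
  have [Zx Vy] := iso_sub isoE Exy.
  have [mU'|mU'] := boolP (m \in U').
    split=> _.
      apply: realization_weaken (Vy) _ => u; rewrite !inE => /predU1P[->//|/andP[_ mu] _].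
      exact: up' mU' (ltW mu).
    apply: realization_weaken (Zx) _ => u; rewrite !inE => /andP[mu _] _.
    exact: up' mU' mu.
  split=> h.
    apply/(Gup _ up' x y) => //; apply: EdomG => //; apply: offZ => // u xu.
    have := realization_in h xu; rewrite inE => pu.
    by apply: contraNneq mU' => <-.
  apply/(Gup _ up' x y) => //; apply: EcodG => //; apply: offV => //.
  apply/eqP; apply: contraNT mU'; exact: realization_in h.
- move=> x y [/Gq //|Exy]; have [Zx Vy] := iso_sub isoE Exy.
  have [mq'|mq'] := boolP (alpha m < q)%O; last first.
    have mqE u : (m <= u)%O -> ~~ (alpha u < q)%O.
      by move=> mu; apply: contra mq'; apply: le_lt_trans; exact: alpha_mono.
    split=> h; [have [u uE xu] := realization_supp h|
                have [u uE xu] := realization_supp h].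
      have := realization_in Zx xu; move: uE; rewrite !inE => uq /andP[/mqE].
      by rewrite (le_lt_trans (alpha_le u)).
    have := realization_in Vy xu; move: uE; rewrite !inE => uq.
    by case/predU1P => [um|/andP[_ /ltW/mqE]]; [move: mq'; rewrite -um|]; rewrite uq.
  pose Vq : {set P} := [set u in V | (alpha u < q)%O]%SET.
  have HR := HB _ (lower_bd_down (q := q)) (_ : alpha m \in bd_down_set q).
  have /HR {}HR : alpha m \in bd_down_set q by rewrite inE.
  have YY : <|dual_link m (bd_down_set q)|> `<=` <|dual_link m (down_set q)|>.
    by apply: dual_linkS; apply/fintype.subsetP => u; rewrite !inE => /ltW.
  have VV : <|Vq|> `<=` <|V|>.
    by apply: realizationS; apply/fintype.subsetP => u; rewrite inE => /andP[].
  have G1R : respects G1 <|dual_link m (bd_down_set q)|> <|Vq|>.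
    move=> u v Guv; have [Yu Vv] := iso_sub isoG1 Guv; case: Guv => Guv _.
    have [h1 h2] := Gq _ _ Guv; split=> h.
      have {}h1 : <|[set x | (alpha x < q)%O]|> v.
        by apply: h1; apply: realization_weaken (h) _ => w; rewrite !inE => /andP[].
      apply: realization_weaken (Vv) _ => w wV vw; rewrite inE wV.
      by have := realization_in h1 vw; rewrite inE.
    have {}h2 : <|[set x | (t x < q)%O]|> u.
      by apply: h2; apply: realization_weaken (h) _ => w; rewrite !inE => /andP[].
    apply: realization_weaken (Yu) _ => w; rewrite !inE => /andP[-> _] uw.
    by have := realization_in h2 uw; rewrite inE.
  have := cone_ext_respects pY isoG1 jV YY VV HR G1R Exy.
  have mVq : m \notin Vq by rewrite inE (negbTE Vm).
  rewrite -realization_setU1 //; last first.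
    by move=> u; rewrite !inE => /andP[/andP[_ /ltW mu] _];
      rewrite /Order.comparable mu orbT.
  move=> [h1 h2]; split=> h.
    have {}h1 : <|m |: Vq|> y.
      apply: h1; apply: realization_weaken (Zx) _ => u; rewrite !inE => /andP[-> _] xu.
      by have := realization_in h xu; rewrite inE.
    apply: realization_weaken h1 _ => u; rewrite !inE.
    by case/predU1P => [->//|/andP[]].
  have {}h2 : <|dual_star m (bd_down_set q)|> x.
    apply: h2; apply: realization_weaken (Vy) _ => u uV yu.
    have := realization_in h yu; rewrite inE => uq.
    by move: uV; rewrite !finset.in_setU1 [_ \in Vq]inE uq andbT.
  by apply: realization_weaken h2 _ => u; rewrite !inE => /andP[].
Qed.

End Step.

Lemma flatten (U : {set P}) :
  (forall x y, x \in U -> (x <= y)%O -> (alpha y <= q)%O -> y \in U) ->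
  (forall x, x \in U -> coning x (down_set q)) -> flattening U.
Proof.
have [n] := ubnP #|U|; elim: n U => // n IH U Un Uup Uc.
have [->|/finset.set0Pn[x0 x0U]] := eqVneq U finset.set0.
  exists set0.
  have M0 : over_part finset.set0 = finset.set0 by apply/setP => x; rewrite !inE.
  split=> //; split=> //.
  - by exists [::]; apply/seteqP; split=> z // [].
  - by move=> x /(realization_set0 M0).
  - by move=> x /(realization_set0 (erefl _)).
(* The number of elements below x serves as a rank: its minimum is attained at
   a minimal element. *)
case: (@arg_minnP _ x0 (mem U) (fun x => #|down_set x|) x0U) => m /= mU mmin.
change (is_true (m \in U)) in mU.
have Um x : x \in U :\ m -> ~~ (x <= m)%O.
  rewrite !inE => /andP[xm xU]; apply/negP => lexm.
  have : (#|down_set x| < #|down_set m|)%N.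
    apply: proper_card; apply/properP; split.
      by apply/fintype.subsetP => y; rewrite !inE => /le_trans; apply.
    exists m; rewrite !inE ?lexx //; apply/negP => lemx.
    by move: xm; rewrite (@le_anti _ _ x m) ?eqxx // lexm.
  by rewrite ltnNge mmin.
rewrite -(finset.setD1K mU); apply: flattening_step; rewrite ?finset.setD1K //.
- by rewrite !inE eqxx.
- exact: Uc.
- apply: IH.
  + by move: Un; rewrite (finset.cardsD1 m) mU.
  + move=> x y xU xy yq; rewrite !inE (Uup x y) //; last first.
      by move: xU; rewrite !inE => /andP[].
    by rewrite andbT; apply/eqP => ym; have := Um _ xU; rewrite -ym xy.
  + by move=> x; rewrite !inE => /andP[_ /Uc].
Qed.

End Flatten.

(** Extends the homeomorphism [g0] over {t < q} to {t <= q}.  With W the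
    realization of the dual link over {t < q}, the homeomorphism [psi]
    identifies the dual link over {t <= q} with the cone over W from a1, and
    [kappa] identifies the dual star over {t < q} with the cone over W from a2.
    Their union is coned off from the vertex (a, q) to the midpoint of a1 and
    a2, and the resulting join of W with the segment is mapped back by the cone
    from a2 over the inverse of [psi]. *)
Lemma extend_coning a q (g0 : set ({ffun T -> R^o} * {ffun cone_poset T -> R^o})) :
  (alpha a < q)%O ->
  (forall x, (a < x)%O -> (alpha x <= q)%O -> coning x (down_set q)) ->
  pl_iso <|dual_star a (bd_down_set q)|> (cone <|dual_link a (bd_down_set q)|>) g0 ->
  (forall y, <|dual_link a (bd_down_set q)|> y -> g0 (y, cone_base y)) ->
  exists N, [/\ pl_iso <|dual_star a (down_set q)|> (cone <|dual_link a (down_set q)|>) N,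
    forall y, <|dual_link a (down_set q)|> y -> N (y, cone_base y) &
    forall x z, g0 (x, z) -> N (x, z)].
Proof.
move=> aq cx iso0 base0.
have [h [hh hb]] := strat aq.
set E := [set x | _]%SET in hh; set dE := [set x | _]%SET in hh hb.
have ME : over_part q E = dual_link a (down_set q).
  apply/setP => x; rewrite !inE; case: (a < p x)%O => //=.
  by case tq: (t x <= q)%O; rewrite ?andbF //= (le_trans (alpha_le x)).
have [|x|G [isoG _ Gq]] := @flatten q E.
- by move=> x y; rewrite !inE => /andP[ax _] /(lt_le_trans ax) -> ->.
- by rewrite inE => /andP[]; exact: cx.
rewrite ME in isoG.
set Y := <|dual_link a (down_set q)|> in isoG *.
set Y' := <|dual_link a (bd_down_set q)|> in iso0 base0.
have pY : polyhedron Y by exact: polyhedron_realization.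
have pY' : polyhedron Y' by exact: polyhedron_realization.
have Y'Y : Y' `<=` Y.
  by apply: dual_linkS; apply/fintype.subsetP => u; rewrite !inE => /ltW.
have dEE : <|dE|> `<=` <|E|>.
  apply: realizationS; apply/fintype.subsetP => u.
  by rewrite !inE => /andP[-> /ltW].
have GY : respects G Y' <|dE|>.
  move=> x y Gxy; have [Yx Ey] := iso_sub isoG Gxy; have [h1 h2] := Gq _ _ Gxy.
  split=> k.
    have {}h1 : <|[set x | (alpha x < q)%O]|> y.
      by apply: h1; apply: realization_weaken (k) _ => w; rewrite !inE => /andP[].
    apply: realization_weaken Ey _ => w; rewrite !inE => /andP[-> _] yw.
    by have := realization_in h1 yw; rewrite inE.
  have {}h2 : <|[set x | (t x < q)%O]|> x.
    by apply: h2; apply: realization_weaken (k) _ => w; rewrite !inE => /andP[].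
  apply: realization_weaken Yx _ => w; rewrite !inE => /andP[-> _] xw.
  by have := realization_in h2 xw; rewrite inE.
have isoG' := iso_restr isoG GY pY' Y'Y dEE.
(* Adding two cone coordinates makes room for the join of W with a segment. *)
pose CC := {ffun cone_poset (cone_poset T) -> R^o}.
pose b2 : {linear {ffun T -> R^o} -> CC} := (cone_base \o cone_base).
pose a1 : CC := cone_base (cone_apex R).
pose a2 : CC := cone_apex R.
pose W := b2 @` Y'.
pose l1 : {linear CC -> R^o} := coord (Some None).
pose l2 : {linear CC -> R^o} := coord None.
have l1E w : l1 w = w (Some None) by [].
have l2E w : l2 w = w None by [].
have b2E y : b2 y = cone_base (cone_base y) by [].
have l1W w : W w -> l1 w = 0.
  by move=> [y _ <-]; rewrite l1E b2E !ffunE mulr0.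
have l2W w : W w -> l2 w = 0 by move=> [y _ <-]; rewrite l2E b2E ffunE.
have l11 : l1 a1 = 1 by rewrite l1E /a1 !ffunE subr0 mul1r.
have l12 : l1 a2 = 0 by rewrite l1E /a2 !ffunE subrr mul0r.
have l21 : l2 a1 = 0 by rewrite l2E /a1 !ffunE.
have l22 : l2 a2 = 1 by rewrite l2E /a2 !ffunE.
have b2i : injective b2 by move=> x y /cone_base_inj/cone_base_inj.
have isoD : pl_iso Y' W (diag Y' b2) by exact: iso_linear.
have j1 := joinable_a1 l1W l11; have j2 := joinable_a2 l2W l22.
have isoX := iso_of_homeo hh.
have Xbase y : <|dE|> y -> diag <|E|> h (y, cone_base y).
  by move=> dy; split; [exact: dEE|rewrite /= hb ?inE //; exact/mem_set].
have isoGD := iso_comp (iso_converse isoG') isoD.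
have pdE : polyhedron <|dE|> by exact: polyhedron_realization.
have isoX' := cone_ext_iso isoX pdE isoGD j1.
have isoPsi := iso_comp isoG isoX'.
set psi := rcomp G _ in isoPsi.
have psiD y : Y' y -> psi (y, b2 y).
  move=> Yy; have [e Ge] := iso_dom isoG' Yy; have [Ge' _] := Ge.
  exists e => //; apply: (cone_ext_sub _ Xbase isoGD).
  by exists y.
have isoK := cone_ext_iso iso0 pY' isoD j2.
set kappa := cone_ext _ _ _ _ in isoK.
have kdom x v : kappa (x, v) -> Y' x -> diag Y' b2 (x, v).
  exact: (cone_ext_dom iso0 base0 pY' isoD j2).
have kcod x v : kappa (x, v) -> W v -> diag Y' b2 (x, v).
  exact: (cone_ext_cod iso0 base0 pY' isoD j2).
have isoTheta : pl_iso (Y `|` <|dual_star a (bd_down_set q)|>)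
    (gcone a1 W `|` gcone a2 W) (psi `|` kappa).
  apply: iso_glue => // x v kxv; have [Zx Wv] := iso_sub isoK kxv.
    move=> Yx; have Y'x : Y' x.
      apply: realization_weaken (Yx) _ => u; rewrite !inE => /andP[-> _] xu.
      by have := realization_in Zx xu; rewrite !inE => /andP[].
    by have [_ /= ->] := kdom _ _ kxv Y'x; exact: psiD.
  move=> Wv'; have Wv0 := cones_meet l1W l11 l12 Wv' Wv.
  by have [Y'x /= ->] := kcod _ _ kxv Wv0; exact: psiD.
have [x0 [px0 tx0]] := pt_exists (ltW aq).
pose mid := (1 / 2) *: a1 + (1 / 2) *: a2.
have ZE : <|dual_star a (down_set q)|> =
    gcone (vertex x0) (Y `|` <|dual_star a (bd_down_set q)|>).
  have -> : dual_star a (down_set q) =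
      (x0 |: (dual_link a (down_set q) :|: dual_star a (bd_down_set q)))%SET.
    apply/setP => x; rewrite !inE !lt_def; apply/idP/idP.
      move=> /andP[-> ->] /=; rewrite !andbT.
      case: (p x =P a) => [px|]; last by rewrite orbT.
      case: (q =P t x) => [tx|]; last by rewrite !orbT.
      rewrite (_ : x = x0) ?eqxx //; apply: le_anti.
      by rewrite !leT px0 tx0 px tx !lexx.
    by case/predU1P => [->|]; [rewrite px0 tx0 !lexx|
      case/orP => [/andP[/andP[_ ->] ->]|/andP[-> /andP[_ ->]]]].
  rewrite realization_setU1; last first.
  - move=> x; rewrite !inE => h'; rewrite /Order.comparable leT px0 tx0.
    by case/orP: h' => /andP[]; [move=> /ltW -> ->|move=> -> /ltW ->].
  - by rewrite !inE px0 tx0 !ltxx !andbF.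
  congr gcone; apply/seteqP; split=> w; last first.
    case; apply: realizationS; apply/fintype.subsetP => x; rewrite !inE => -> //.
    by rewrite orbT.
  move=> Uw; have [/existsP[x /andP[wx /eqP px]]|nx] :=
      boolP [exists x, (w x != 0) && (p x == a)]; [right|left].
    apply: realization_weaken (Uw) _ => y; rewrite !inE => /orP[|//] /andP[ay ty] wy.
    have [_ _ _ wC] := Uw; have := wC x y wx wy.
    have tx : (t x < q)%O.
      have := realization_in Uw wx; rewrite !inE px ltxx /=.
      by case/andP.
    rewrite /Order.comparable !leT px (ltW ay) (lt_geF ay) /= => tyx.
    exact: le_lt_trans tyx tx.
  apply: realization_weaken (Uw) _ => y; rewrite !inE.
  case/orP => [//|/andP[ay ty] wy]; rewrite (ltW ty) andbT lt_def ay andbT.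
  by apply: contra nx => ya; apply/existsP; exists y; rewrite wy.
have x0N : joinable (vertex x0 : {ffun T -> R^o}) (Y `|` <|dual_star a (bd_down_set q)|>).
  exists (fun w : {ffun T -> R^o} => w x0) => s y _ h'.
  rewrite !ffunE eqxx /GRing.scale /= mulr1.
  have [->|y0] : s = 1 \/ y x0 = 0; last by rewrite y0 mulr0 add0r.
    case: h' => [|h']; [by left|right]; apply/eqP.
    apply: contraT => yx; case: h' => /realization_in/(_ yx).
      by rewrite !inE px0 ltxx.
    by rewrite !inE tx0 ltxx andbF.
  by rewrite subrr mul0r add0r.
have jm : joinable mid (gcone a1 W `|` gcone a2 W).
  exact: (joinable_mid l1W l2W l11 l12 l21 l22).
have isoTh := iso_gcone x0N jm isoTheta.
rewrite -ZE (double_cone a1 a2 W) in isoTh.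
have isoB : pl_iso Y (cone_base @` Y) (diag Y (@cone_base R d T)).
  by apply: iso_linear => //; exact: cone_base_inj.
have isoPB := iso_comp (iso_converse isoPsi) isoB.
have jc := @joinable_a2_cone _ _ l2 a1 a2 W l2W l21 l22.
have isoXi := iso_gcone jc (joinable_apex Y) isoPB.
rewrite -coneE in isoXi.
have isoN := iso_comp isoTh isoXi.
eexists; split; first exact: isoN.
- move=> y Yy; have [v psiv] := iso_dom isoPsi Yy.
  by exists v; apply: gcone_base; [left|exists y].
- move=> x z g0xz; have [Zx _] := iso_sub iso0 g0xz.
  have [v kv] := iso_dom isoK Zx; exists v; first by apply: gcone_base; right.
  case: (kv) => z' g0xz' /gcone_relP[s [k [k' [s01 h' zE vE]]]].
  rewrite /= in g0xz' zE vE; rewrite (iso_fun iso0 g0xz g0xz') /=.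
  exists s, (k', k); split=> //; last by rewrite zE vE.
  case: h' => [|[w [Y'w /= kE] [_ /= k'E]]]; [by left|right].
  by exists w; [rewrite k'E; exact: psiD|split=> //; exact: Y'Y].
Qed.

(** The realization of the new part, over {t <= q}, meets the old one in the
    realization over {t < q}, where [extend_coning] agrees with the old
    homeomorphism; the same holds for the cones over the dual links. *)
Lemma coning_add a q (B : {set Q}) : lower (q |: B)%SET ->
  q \notin B -> (forall b, b \in B -> ~~ (q <= b)%O) -> (alpha a < q)%O ->
  (forall x, (a < x)%O -> (alpha x <= q)%O -> coning x (down_set q)) ->
  coning a B -> coning a (q |: B)%SET.
Proof.
move=> lqB qB Bq aq cx [G [isoG Gbase Gres]].
have bd_B : (bd_down_set q \subset B)%SET.
  apply/fintype.subsetP => b; rewrite inE => bq.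
  have := lqB b q (finset.setU11 q B) (ltW bq).
  by rewrite finset.in_setU1 lt_eqF.
have a_bd : alpha a \in bd_down_set q by rewrite inE.
have B_bd b : b \in B -> (b <= q)%O -> (b < q)%O.
  by move=> bB; rewrite lt_def => ->; rewrite andbT; apply: contraNneq qB => ->.
have resbd := Gres _ (lower_bd_down (q := q)) a_bd.
have iso0 := iso_restr isoG resbd (polyhedron_realization _) (dual_starS bd_B)
  (coneS (dual_linkS bd_B)).
set g0 := restr G _ in iso0.
have base0 y : <|dual_link a (bd_down_set q)|> y -> g0 (y, cone_base y).
  by move=> Yy; split; [apply: Gbase; exact: dual_linkS Yy|exact: dual_link_star].
have [N [isoN Nbase Ng0]] := extend_coning aq cx iso0 base0.
(* As q is not in C, a point of the new part that also lies over C lies over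
   t < q. *)
have ZI (C : {set Q}) x : q \notin C ->
    <|dual_star a (down_set q)|> x -> <|dual_star a C|> x ->
    <|dual_star a (bd_down_set q)|> x.
  move=> qC Zx Cx; apply: realization_weaken (Zx) _ => u.
  rewrite !inE => /andP[-> tu] xu; rewrite lt_def tu andbT.
  have := realization_in Cx xu; rewrite inE => /andP[_ uC].
  by apply: contraNneq qC => ->.
have YI (C : {set Q}) z : q \notin C -> cone <|dual_link a (down_set q)|> z ->
    cone <|dual_link a C|> z -> cone <|dual_link a (bd_down_set q)|> z.
  move=> qC Yz Cz; apply: coneS (cone_meet Yz Cz) => y [Yy Cy].
  apply: realization_weaken (Yy) _ => u.
  rewrite !inE => /andP[-> tu] yu; rewrite lt_def tu andbT.
  have := realization_in Cy yu; rewrite inE => /andP[_ uC].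
  by apply: contraNneq qC => ->.
have NdomG x z : N (x, z) -> <|dual_star a (bd_down_set q)|> x -> G (x, z).
  move=> Nxz Zx; have [z' gz'] := iso_dom iso0 Zx.
  by rewrite (iso_fun isoN Nxz (Ng0 _ _ gz')); case: gz'.
have NcodG x z : N (x, z) -> cone <|dual_link a (bd_down_set q)|> z -> G (x, z).
  move=> Nxz Yz; have [x' gx'] := iso_cod iso0 Yz.
  by rewrite (iso_inj isoN Nxz (Ng0 _ _ gx')); case: gx'.
have split_chain (S : {set Q} -> {set T}) :
    (forall (C D : {set Q}) (w : {ffun T -> R^o}),
       (forall u, w u != 0 -> t u \in C -> t u \in D) ->
       <|S C|> w -> <|S D|> w) ->
    <|S (q |: B)%SET|> = <|S B|> `|` <|S (down_set q)|>.
  move=> Smono; apply/seteqP; split=> w; last first.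
    case=> Sw; first by apply: Smono Sw => u _; rewrite finset.in_setU1 orbC => ->.
    by apply: Smono Sw => u _; rewrite inE; exact: lqB (finset.setU11 q B).
  move=> Sw; have [/existsP[x /andP[wx /eqP tx]]|nx] :=
      boolP [exists x, (w x != 0) && (t x == q)]; [right|left].
    apply: Smono (Sw) => u wu; rewrite finset.in_setU1 inE.
    case/predU1P => [-> //|uB]; have [_ _ _ wC] := Sw.
    have := wC x u wx wu; rewrite /Order.comparable !leT tx.
    by rewrite (negbTE (Bq _ uB)) andbF => /andP[].
  apply: Smono (Sw) => u wu; rewrite finset.in_setU1 => /predU1P[tu|//].
  by case/existsP: nx; exists u; rewrite wu tu eqxx.
have ZU : <|dual_star a (q |: B)|> = <|dual_star a B|> `|` <|dual_star a (down_set q)|>.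
  apply: (split_chain (dual_star a)) => C D w CD Cw.
  by apply: realization_weaken Cw _ => u; rewrite !inE => /andP[-> uC] /CD ->.
have YU : <|dual_link a (q |: B)|> = <|dual_link a B|> `|` <|dual_link a (down_set q)|>.
  apply: (split_chain (dual_link a)) => C D w CD Cw.
  by apply: realization_weaken Cw _ => u; rewrite !inE => /andP[-> uC] /CD ->.
exists (G `|` N); split.
- rewrite ZU YU coneU; apply: iso_glue => // x z Nxz; have [Zx Yz] := iso_sub isoN Nxz.
    by move=> Zx'; apply: NdomG => //; exact: ZI Zx Zx'.
  by move=> Yz'; apply: NcodG => //; exact: YI Yz Yz'.
- by rewrite YU => y [/Gbase|/Nbase]; [left|right].
- move=> C lC aC x z [|Nxz]; first exact: Gres.
  have [Zx Yz] := iso_sub isoN Nxz.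
  have [qC|qC] := boolP (q \in C).
    have dC : (down_set q \subset C)%SET.
      by apply/fintype.subsetP => b; rewrite inE; exact: lC.
    by split=> _; [exact: coneS (dual_linkS dC) _ Yz|exact: dual_starS dC _ Zx].
  split=> [Zx'|Yz'].
    by apply/(Gres C lC aC x z) => //; apply: NdomG => //; exact: ZI Zx Zx'.
  by apply/(Gres C lC aC x z) => //; apply: NcodG => //; exact: YI Yz Yz'.
Qed.

(** The point (a, alpha a) is then the greatest element of the dual star, and
    all of the dual star lies over alpha a; so the conditions on smaller lower
    sets are trivial. *)
Lemma coning_min a (B : {set Q}) : alpha a \in B ->
  (forall b, b \in B -> ~~ (alpha a < b)%O) -> coning a B.
Proof.
move=> aB Bmin; have [x0 [px0 tx0]] := pt_exists (lexx (alpha a)).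
have tE u : u \in dual_star a B -> t u = alpha a.
  rewrite inE => /andP[au /Bmin]; have := le_trans (alpha_mono au) (alpha_le u).
  by rewrite le_eqVlt => /predU1P[->|->].
have x0Y : x0 \notin dual_link a B by rewrite inE px0 ltxx.
have ZE : <|dual_star a B|> = gcone (vertex x0) <|dual_link a B|>.
  have -> : dual_star a B = (x0 |: dual_link a B)%SET.
    apply/setP => u; apply/idP/idP => [uZ|]; last first.
      by rewrite !inE => /predU1P[->|/andP[/ltW -> ->//]]; rewrite px0 tx0 lexx.
    have tu := tE _ uZ; move: uZ; rewrite !inE => /andP[au uB].
    rewrite uB andbT lt_def au andbT; case: (p u =P a) => [pu|]; last by rewrite orbT.
    by rewrite orbF; apply/eqP/le_anti; rewrite !leT px0 tx0 pu tu !lexx.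
  apply: realization_setU1 => // u uY; rewrite /Order.comparable !leT px0 tx0.
  have uZ : u \in dual_star a B by move: uY; rewrite !inE => /andP[/ltW -> ->].
  by move: uY; rewrite inE (tE _ uZ) lexx andbT => /andP[/ltW -> _].
have isoB : pl_iso <|dual_link a B|> (cone_base @` <|dual_link a B|>)
    (diag <|dual_link a B|> (@cone_base R d T)).
  by apply: iso_linear; [exact: polyhedron_realization|exact: cone_base_inj].
have isoG := iso_gcone (joinable_vertex x0Y) (joinable_apex _) isoB.
rewrite -ZE -coneE in isoG.
eexists; split; first exact: isoG.
- by move=> y Yy; apply: gcone_base.
- move=> C lC aC x z Gxz; have [Zx Yz] := iso_sub isoG Gxz.
  split=> _; last first.
    apply: realization_weaken Zx _ => u uZ _; have tu := tE _ uZ.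
    by move: uZ; rewrite !inE tu aC => /andP[->].
  apply: coneS Yz; apply: realizationS; apply/fintype.subsetP => u uY.
  have uZ : u \in dual_star a B by move: uY; rewrite !inE => /andP[/ltW -> ->].
  by move: uY; rewrite !inE (tE _ uZ) aC => /andP[->].
Qed.

(** Induction on the number of elements above a, then on the size of B; q is a
    maximal element of B among those above alpha a. *)
Lemma coning_lower a (B : {set Q}) : lower B -> alpha a \in B -> coning a B.
Proof.
have [n] := ubnP #|[set x | (a < x)%O]%SET|; elim: n a B => // n IH a B an.
have cx x C : (a < x)%O -> lower C -> alpha x \in C -> coning x C.
  move=> ax; apply: IH; rewrite ltnS in an; apply: leq_trans an.
  apply: proper_card.
  apply/properP; split.
    by apply/fintype.subsetP => y; rewrite !inE; exact: lt_trans.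
  by exists x; rewrite !inE ?ltxx.
have [k] := ubnP #|B|; elim: k B => // k IHk B Bk lB aB.
have [/existsP[b /andP[bB ab]]|nb] := boolP [exists b, (b \in B) && (alpha a < b)%O];
  last first.
  apply: coning_min => // b bB; apply: contra nb => ab.
  by apply/existsP; exists b; rewrite bB.
pose M := [set c in B | (alpha a < c)%O]%SET.
have bM : b \in M by rewrite inE bB.
case: (@arg_maxnP _ b (mem M) (fun c => #|down_set c|) bM) => q /= qM qmax.
change (is_true (q \in M)) in qM.
move: (qM); rewrite inE => /andP[qB aq].
have Bq c : c \in B -> (q <= c)%O -> c = q.
  move=> cB qc; apply/eqP; apply: contraT => cq.
  have : (#|down_set q| < #|down_set c|)%N.
    apply: proper_card; apply/properP; split.
      by apply/fintype.subsetP => y; rewrite !inE => /le_trans; apply.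
    exists c; rewrite !inE ?lexx //; apply: contra cq => cq.
    by apply/eqP/le_anti; rewrite cq.
  have cM : c \in M by rewrite inE cB (lt_le_trans aq).
  by rewrite ltnNge (qmax c cM).
have lB' : lower (B :\ q).
  move=> x y; rewrite !inE => /andP[yq yB] xy; rewrite (lB x y) // andbT.
  by apply: contra yq => /eqP xq; apply/eqP/Bq => //; rewrite -xq.
have aB' : alpha a \in B :\ q by rewrite !inE aB andbT lt_eqF.
rewrite -(finset.setD1K qB); apply: coning_add => //.
- by rewrite finset.setD1K.
- by rewrite !inE eqxx.
- move=> c; rewrite !inE => /andP[cq cB]; apply: contra cq => qc.
  by apply/eqP/Bq.
- move=> x ax xq; apply: cx => //; first exact: lower_down.
  by rewrite inE.
- by apply: IHk => //; move: Bk; rewrite (finset.cardsD1 q) qB.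
Qed.

End Main.

(** * The pullback *)

Section PullbackOrder.
Context {dP dQ : Order.disp_t} {P : finPOrderType dP} {Q : finPOrderType dQ}.
Variables (alpha : P -> Q) (alpha_mono : monotone_map alpha).

Let X := pullback alpha (@r_map dQ Q).

Definition base_pt (x : X^d) : P := pb_fst (x : X).
Definition top_pt (x : X^d) : Q := itv_hi (pb_snd (x : X) : sharp Q).

Lemma itv_lo_pb (x : X) : itv_lo (pb_snd x : sharp Q) = alpha (pb_fst x).
Proof. by apply/esym/eqP; exact: (svalP x). Qed.

Lemma le_pbE (x y : X^d) :
  (x <= y)%O = (base_pt y <= base_pt x)%O && (top_pt x <= top_pt y)%O.
Proof.
have -> : (x <= y)%O = (pb_fst (y : X) <= pb_fst (x : X))%O &&
    itv_le (pb_snd (x : X)) (pb_snd (y : X)) by [].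
rewrite itv_leE !itv_lo_pb /base_pt /top_pt.
case le: (pb_fst y <= pb_fst x)%O => //=.
by rewrite alpha_mono.
Qed.

Lemma alpha_base_le x : (alpha (base_pt x) <= top_pt x)%O.
Proof. by rewrite /base_pt -itv_lo_pb; exact: (svalP (pb_snd (x : X) : sharp Q)). Qed.

Lemma pb_pt a q : (alpha a <= q)%O -> exists x, base_pt x = a /\ top_pt x = q.
Proof.
move=> aq; pose I : sharp Q := exist _ (alpha a, q) aq.
have E : alpha (a, I : hposet Q).1 == r_map (a, I : hposet Q).2 by [].
by exists (exist _ (a, I : hposet Q) E).
Qed.

End PullbackOrder.

Theorem theorem18p4 (R : realType) (dP dQ : Order.disp_t)
    (P : finPOrderType dP) (Q : finPOrderType dQ) (alpha : P -> Q)
    (alpha_mono : monotone_map alpha) :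
  let X := pullback alpha (@r_map dQ Q) in
  let f : X -> P := @pb_fst _ _ _ _ _ _ alpha r_map in
  let beta : X -> hposet Q := @pb_snd _ _ _ _ _ _ alpha r_map in
  stratification_map R alpha ->
  @fiberwise_subdivision_map R _ _ _ X^d P^d Q^d
    (dual_map f) (dual_map alpha)
    ((sharp_map \o (dual_map beta : X^d -> sharp Q)) : X^d -> Q).
Proof.
move=> X f beta [_ strat].
have strat' q a : (alpha a < q)%O ->
  exists h : {ffun P -> R^o} -> {ffun cone_poset P -> R^o},
    pl_homeo (realization R [set x | (a < x)%O && (alpha x <= q)%O]%SET)
             (cone (realization R [set x | (a < x)%O && (alpha x < q)%O]%SET)) h /\
    {in realization R [set x | (a < x)%O && (alpha x < q)%O]%SET, h =1 cone_base}.
  move=> aq; have [_ /(_ a)] := strat q; rewrite !inE aq => /(_ isT).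
  have -> : lk a (alpha @^-1: down_set q)%SET =
      [set x | (a < x)%O && (alpha x <= q)%O]%SET.
    by apply/setP => x; rewrite !inE andbC.
  have -> // : lk a (alpha @^-1: bd_down_set q)%SET =
      [set x | (a < x)%O && (alpha x < q)%O]%SET.
  by apply/setP => x; rewrite !inE andbC.
have leT := le_pbE alpha_mono.
have main (a : P) : exists h : {ffun X^d -> R^o} -> {ffun cone_poset X^d -> R^o},
      [/\ pl_homeo (realization R (dual_map f @^-1: down_set (a : P^d))%SET)
            (cone (realization R (dual_map f @^-1: bd_down_set (a : P^d))%SET)) h,
          {in realization R (dual_map f @^-1: bd_down_set (a : P^d))%SET,
             h =1 cone_base} &
          forall b : Q,
          let F : {set X^d} := ((sharp_map \o (dual_map beta : X^d -> sharp Q))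
             @^-1: down_set b)%SET in
          (F :&: dual_map f @^-1: down_set (a : P^d) != finset.set0)%SET ->
          h @` realization R (F :&: dual_map f @^-1: down_set (a : P^d))%SET
          = cone (realization R (F :&: dual_map f @^-1: bd_down_set (a : P^d))%SET)].
  have lT : lower [set: Q]%SET by move=> x y _ _; rewrite inE.
  have aT : alpha a \in [set: Q]%SET by rewrite inE.
  have [G [isoG Gbase Gres]] := coning_lower (R := R) alpha_mono leT
    (@alpha_base_le _ _ _ _ alpha) (@pb_pt _ _ _ _ alpha) strat' lT aT.
  have ZE : dual_star (@base_pt _ _ _ _ alpha) (@top_pt _ _ _ _ alpha) a [set: Q]%SET =
      (dual_map f @^-1: down_set (a : P^d))%SET.
    by apply/setP => x; rewrite !inE andbT.
  have YE : dual_link (@base_pt _ _ _ _ alpha) (@top_pt _ _ _ _ alpha) a [set: Q]%SET =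
      (dual_map f @^-1: bd_down_set (a : P^d))%SET.
    by apply/setP => x; rewrite !inE andbT.
  rewrite ZE YE in isoG Gbase.
  have [h hh hG] := homeo_of_iso isoG; exists h; split=> //.
    move=> y /set_mem Yy; apply: (iso_fun isoG _ (Gbase y Yy)); apply: hG.
    by rewrite -ZE; apply: dual_link_star; rewrite YE.
  move=> b F /finset.set0Pn[x]; rewrite !inE => /andP[xb ax].
  have ab : alpha a \in down_set b.
    rewrite inE; apply: le_trans xb; apply: le_trans (alpha_base_le x).
    exact: alpha_mono.
  have := Gres _ (lower_down (q := b)) ab.
  have -> : dual_star (@base_pt _ _ _ _ alpha) (@top_pt _ _ _ _ alpha) a (down_set b) =
      (F :&: dual_map f @^-1: down_set (a : P^d))%SET.
    by apply/setP => u; rewrite !inE andbC.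
  have -> : dual_link (@base_pt _ _ _ _ alpha) (@top_pt _ _ _ _ alpha) a (down_set b) =
      (F :&: dual_map f @^-1: bd_down_set (a : P^d))%SET.
    by apply/setP => u; rewrite !inE andbC.
  move=> res.
  have FZ : realization R (F :&: dual_map f @^-1: down_set (a : P^d))%SET `<=`
      realization R (dual_map f @^-1: down_set (a : P^d))%SET.
    by apply: realizationS; exact: finset.subsetIr.
  have FY : realization R (F :&: dual_map f @^-1: bd_down_set (a : P^d))%SET `<=`
      realization R (dual_map f @^-1: bd_down_set (a : P^d))%SET.
    by apply: realizationS; exact: finset.subsetIr.
  apply/seteqP; split=> [_ [w Fw <-]|z Fz].
    by apply/(res w) => //; apply/hG/FZ.
  have [w Gwz] := iso_cod isoG (coneS FY Fz).
  have [Zw _] := iso_sub isoG Gwz.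
  exists w; last by apply: (iso_fun isoG) Gwz; exact: hG.
  exact/(res w z).
split.
- split; first by move=> x y /=; rewrite leT => /andP[].
  move=> a; have [h [hh hb _]] := main a; exists h; split=> //.
  by rewrite realization_cone.
- split; first by move=> x y; exact: alpha_mono.
  by move=> x y /=; rewrite leT => /andP[].
- move=> b; apply/setP => a; rewrite inE; apply/imsetP/idP.
    move=> [x]; rewrite !inE => xb ->; apply: le_trans xb.
    exact: alpha_base_le.
  rewrite inE => ab; have [x [xa xb]] := @pb_pt _ _ _ _ alpha a b ab.
  exists x; last by rewrite -xa.
  by rewrite !inE; change (top_pt x <= b)%O; rewrite xb.
- exact: main.
Qed.
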